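(* Let $S$ be a set of $n$ i.i.d. samples $(x_i,y_i)$ from the linear model $y_i=x_i^T\beta^*+z_i$, where $\beta^*\in\mathbb{R}^p$, the covariates $x_i\in\mathbb{R}^p$ satisfy $\mathbb{E}x_i=0$, $\mathbb{E}x_ix_i^T=I$ and $(4,2)$-hypercontractivity with parameter $\sigma_{x,4}\le C$ for a known constant $C$, and the noise variables $z_i$ are i.i.d., independent of the covariates, with $\mathbb{E}z_i=0$ and $\mathbb{E}z_i^2=\sigma^2$. Let $\widehat\beta_1$ be any estimator, which might depend on $S$, satisfying $\|\widehat\beta_1-\beta^*\|_2=O(\sigma)$. Let $T$ be an $\epsilon$-corrupted version of $S$ (where $T$ might depend on $\widehat\beta_1$). Let $\tau\in(0,1)$ and set $\epsilon'=\Theta\left(\epsilon+\frac{\log(1/\tau)}{n}+\frac{p\log(pn)}{n}\right)$, where $\epsilon'$ is less than a small constant. Then running the filtering algorithm (defined in the context) with inputs $$T_1:=\left\{\widehat\beta_1+(y_i'-x_i'^T\widehat\beta_1)x_i':(x_i',y_i')\in T\right\}$$ and $\epsilon'$ returns a set $T'$ such that, with probability at least $1-2\tau$, $$\|\widehat\beta-\beta^*\|_2\lesssim\sigma\left(\sqrt{\frac{p\log(pn)}{n}}+\sqrt\epsilon+\sqrt{\frac{\log(1/\tau)}{n}}\right),$$ where $\widehat\beta$ is the empirical mean of the vectors in $T'$.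
   Context: Hypercontractivity: a random vector $X\in\mathbb{R}^p$ satisfies $(4,2)$-hypercontractivity with parameter $\sigma_4$ if $(\mathbb{E}|v^TX|^4)^{1/4}\le\sigma_4(\mathbb{E}(v^TX)^2)^{1/2}$ for all unit vectors $v$. Corruption (strong contamination model): $T$ is an $\epsilon$-corrupted version of $S$ if $|T|=|S|$ and $|T\cap S|\ge(1-\epsilon)|S|$; $T$ may depend on $S$ arbitrarily. Stability: for $0<\epsilon<1/2$ and $\delta\ge\epsilon$, a finite multiset $S\subset\mathbb{R}^p$ is $(\epsilon,\delta)$-stable with respect to $\mu$ and $\sigma^2$ if for all $S'\subseteq S$ with $|S'|\ge(1-\epsilon)|S|$: $\left\|\frac1{|S'|}\sum_{x\in S'}x-\mu\right\|_2\le\sigma\delta$ and $\left\|\frac1{|S'|}\sum_{x\in S'}(x-\mu)(x-\mu)^T-\sigma^2I\right\|_2\le\frac{\sigma^2\delta^2}{\epsilon}$. Filter: the iterative filtering algorithm from robust mean estimation is a computationally efficient randomized algorithm which takes a finite multiset $T\subset\mathbb{R}^p$ and $\epsilon'<1/2$ and outputs $T'\subseteq T$, with the following guarantee, for absolute constants $c_1,c_2,c_3>0$ and any large enough constant $C_0>1$: if $T$ is an $\epsilon'$-corrupted version of a multiset $S$ of $n$ points containing $S'\subseteq S$ with $|S'|\ge(1-\epsilon')|S|$ that is $(C_0\epsilon',\delta)$-stable with respect to $\mu$ and $\sigma^2$, then with probability at least $1-O(\exp(-\Omega(n\epsilon')))$ over its internal randomness, $|T'|\ge(1-c_1\epsilon')|T|$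 and $T'$ is $(c_2C_0\epsilon',c_3\delta)$-stable with respect to $\mu$ and $\sigma^2$. Constants: implied constants are positive and may depend only on $C$ and the constant in $\|\widehat\beta_1-\beta^*\|_2=O(\sigma)$; $\epsilon'=\Theta(B)$ means a suitable (sufficiently large) constant multiple of $B$. *)

(* Defs.v *)
From HB Require Import structures.
From mathcomp Require Import all_boot all_order all_algebra.
From mathcomp Require Import finmap multiset.
From mathcomp Require Import all_classical all_reals all_analysis.

Set Implicit Arguments.
Unset Strict Implicit.
Unset Printing Implicit Defensive.

Import Order.TTheory GRing.Theory Num.Theory.

Local Open Scope mset_scope.
Local Open Scope classical_set_scope.
Local Open Scope ring_scope.

(* The canonical norm `|v| on matrices is the sup norm, not the Euclidean one. *)

Definition dotv (R : realType) (p : nat) (u v : 'cV[R]_p) : R :=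
  (u^T *m v) ord0 ord0.

Definition norm2 (R : realType) (p : nat) (v : 'cV[R]_p) : R :=
  Num.sqrt (dotv v v).

Definition opnorm2 (R : realType) (p : nat) (M : 'M[R]_p) : R :=
  sup [set norm2 (M *m v) | v in [set v : 'cV[R]_p | norm2 v = 1]].

Definition mean (R : realType) (p : nat) (S : {mset 'cV[R]_p}) : 'cV[R]_p :=
  (size S)%:R^-1 *: \sum_(x <- S) x.

Definition second_moment (R : realType) (p : nat) (S : {mset 'cV[R]_p})
    (mu : 'cV[R]_p) : 'M[R]_p :=
  (size S)%:R^-1 *: \sum_(x <- S) (x - mu) *m (x - mu)^T.

Definition corrupted (R : realType) (X : choiceType) (eps : R)
    (S T : {mset X}) : Prop :=
  size T = size S /\ (1 - eps) * (size S)%:R <= (size (T `&` S)%mset)%:R.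

(* The third scalar is sigma, not sigma ^ 2. *)
Definition stable (R : realType) (p : nat) (eps delta : R)
    (S : {mset 'cV[R]_p}) (mu : 'cV[R]_p) (sigma : R) : Prop :=
  [/\ 0 < eps, eps < 1 / 2, eps <= delta &
      forall S' : {mset 'cV[R]_p}, (S' `<=` S)%mset ->
        (1 - eps) * (size S)%:R <= (size S')%:R ->
        norm2 (mean S' - mu) <= sigma * delta /\
        opnorm2 (second_moment S' mu - (sigma ^+ 2)%:M)
          <= sigma ^+ 2 * delta ^+ 2 / eps].

(* Tuples, unlike matrices, carry a measurable structure (the Borel
   sigma-algebra of R^p), so a random vector is a random variable with values
   in [p.-tuple R], read as a column through [colv]. *)

Definition colv (R : realType) (p : nat) (t : p.-tuple R) : 'cV[R]_p :=
  \col_(i < p) tnth t i.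

Definition mutually_independent d (Omega : measurableType d) (R : realType)
    (P : probability Omega R) d' (E : measurableType d') (I : finType)
    (X : I -> Omega -> E) : Prop :=
  forall (J : {set I}) (A : I -> set E), (forall i, measurable (A i)) ->
    P [set w | forall i, i \in J -> A i (X i w)]
    = (\prod_(i in J) P [set w | A i (X i w)])%E.

Definition identically_distributed d (Omega : measurableType d) (R : realType)
    (P : probability Omega R) d' (E : measurableType d') (I : finType)
    (X : I -> Omega -> E) : Prop :=
  forall (i j : I) (A : set E), measurable A ->
    P [set w | A (X i w)] = P [set w | A (X j w)].

Definition iid d (Omega : measurableType d) (R : realType)
    (P : probability Omega R) d' (E : measurableType d') (I : finType)
    (X : I -> Omega -> E) : Prop :=
  mutually_independent P X /\ identically_distributed P X.

Definition independent_of d (Omega : measurableType d) (R : realType)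
    (P : probability Omega R) d1 (E1 : measurableType d1)
    d2 (E2 : measurableType d2) (X : Omega -> E1) (Y : Omega -> E2) : Prop :=
  forall (A : set E1) (B : set E2), measurable A -> measurable B ->
    P [set w | A (X w) /\ B (Y w)]
    = (P [set w | A (X w)] * P [set w | B (Y w)])%E.

Definition hypercontractive42 d (Omega : measurableType d) (R : realType)
    (P : probability Omega R) (p : nat) (X : Omega -> 'cV[R]_p)
    (sigma4 : R) : Prop :=
  forall v : 'cV[R]_p, norm2 v = 1 ->
    ('N[P]_4%:E[(fun w => (dotv v (X w))%:E)]
     <= sigma4%:E * 'N[P]_2%:E[(fun w => (dotv v (X w))%:E)])%E.

Definition isotropic d (Omega : measurableType d) (R : realType)
    (P : probability Omega R) (p : nat) (X : Omega -> 'cV[R]_p) : Prop :=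
  (forall j : 'I_p, ('E_P[(fun w => X w j ord0)%R] = 0)%E) /\
  (forall j k : 'I_p,
     ('E_P[(fun w => (X w *m (X w)^T) j k)%R] = ((1%:M : 'M[R]_p) j k)%:E)%E).

Definition response (R : realType) (p n : nat) (Omega : Type)
    (betastar : 'cV[R]_p) (x : 'I_n -> Omega -> p.-tuple R)
    (z : 'I_n -> Omega -> R) (i : 'I_n) (w : Omega) : R :=
  dotv (colv (x i w)) betastar + z i w.

Definition sample (R : realType) (p n : nat) (Omega : Type)
    (betastar : 'cV[R]_p) (x : 'I_n -> Omega -> p.-tuple R)
    (z : 'I_n -> Omega -> R) (w : Omega) : {mset ('cV[R]_p * R)%type} :=
  seq_mset [seq (colv (x i w), response betastar x z i w) | i <- enum 'I_n].

Definition linear_model d (Omega : measurableType d) (R : realType)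
    (P : probability Omega R) (p n : nat) (betastar : 'cV[R]_p)
    (x : 'I_n -> {RV P >-> p.-tuple R}) (z : 'I_n -> {RV P >-> R})
    (sigma4 sigma : R) : Prop :=
  [/\ iid P (fun i w => (x i w, response betastar x z i w)),
      iid P z,
      independent_of P (fun w => [tuple x i w | i < n])
                       (fun w => [tuple z i w | i < n]),
      forall i, isotropic P (fun w => colv (x i w)) /\
                hypercontractive42 P (fun w => colv (x i w)) sigma4 &
      forall i, ('E_P[z i] = 0)%E /\
                ('E_P[(fun w => z i w ^+ 2)%R] = (sigma ^+ 2)%:E)%E].

Definition gradient_step (R : realType) (p : nat) (b : 'cV[R]_p)
    (T : {mset ('cV[R]_p * R)%type}) : {mset 'cV[R]_p} :=
  seq_mset [seq b + (xy.2 - dotv xy.1 b) *: xy.1 | xy <- T].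

(* The last argument is the internal randomness of the algorithm. *)

Definition algorithm (R : realType) dr (Rnd : measurableType dr) : Type :=
  forall p : nat, {mset 'cV[R]_p} -> R -> Rnd -> {mset 'cV[R]_p}.

(* [Cmin] renders "any large enough constant C0 > 1"; [A] and [a] are the
   implied constants of the failure probability O(exp(- Omega(n * eps))).
   Since [stable] includes the constraints on its parameters, the guarantee is
   required only for C0 * eps < 1 / 2. *)
Definition filter_guarantee (R : realType) dr (Rnd : measurableType dr)
    (Q : probability Rnd R) (Filter : algorithm R Rnd) : Prop :=
  exists c1 c2 c3 Cmin : R, [/\ 0 < c1, 0 < c2, 0 < c3 &
    forall C0 : R, 1 < C0 -> Cmin <= C0 ->
    exists A a : R, [/\ 0 < A, 0 < a &
      forall (p n : nat) (S T S' : {mset 'cV[R]_p}) (eps delta sigma : R)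
        (mu : 'cV[R]_p),
        (0 < p)%N -> (0 < n)%N -> 0 < eps -> eps < 1 / 2 -> 0 <= sigma ->
        size S = n -> corrupted eps S T ->
        (S' `<=` S)%mset -> (1 - eps) * (size S)%:R <= (size S')%:R ->
        stable (C0 * eps) delta S' mu sigma ->
        ((1 - A * expR (- (a * (n%:R * eps))))%:E
         <= Q [set r | ((1 - c1 * eps) * (size T)%:R
                         <= (size (Filter p T eps r))%:R)%R /\
                       stable (c2 * C0 * eps)%R (c3 * delta)%R
                         (Filter p T eps r) mu sigma])%E]].

Definition is_filter (R : realType) dr (Rnd : measurableType dr)
    (Q : probability Rnd R) (Filter : algorithm R Rnd) : Prop :=
  [/\ forall (p : nat) (T : {mset 'cV[R]_p}) (eps : R) (r : Rnd),
        0 < eps -> eps < 1 / 2 -> (Filter p T eps r `<=` T)%mset,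
      forall (p : nat) (T U : {mset 'cV[R]_p}) (eps : R),
        0 < eps -> eps < 1 / 2 -> measurable [set r | Filter p T eps r = U] &
      filter_guarantee Q Filter].

(* Main.v *)
Require Import Defs.
From HB Require Import structures.
From mathcomp Require Import all_boot all_order all_algebra.
From mathcomp Require Import ring lra.
From mathcomp Require Import finmap multiset.
From mathcomp Require Import all_classical all_reals all_analysis.
From mathcomp Require Import measurable_realfun.

(** Put betastar - b = sigma K1 a with |a| <= 1, and w_i = z_i / sigma.  The
    gradient point of the i-th sample is then betastar + sigma h_i, where
    h_i = (K1 <x_i, a> + w_i) x_i - K1 a, and the score <h_i, v> in a unit
    direction v is centered with a variance bounded by a constant: this is
    where the fourth moments of the covariates are spent ([has_mean_score],
    [has_mean_score2]).  Stability with delta of order sqrt eps' only asks,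
    for most of the h_i, that their second moments be bounded in all
    directions and that their mean be O(sqrt eps') ([stable_image]).

    Since the estimator b and the adversary see the sample, this must hold
    for all a at once; since the scores have only two moments, only truncated
    statistics concentrate exponentially.  For fixed a and v, and a small
    multiple kappa of eps', the sums over i of min(kappa <h_i, v>^2, 1) and of
    sqrt kappa <h_i, v> clipped to [-1, 1] are O(kappa n) outside an event of
    probability exp(- Omega(kappa n)) ([chernoff_independent]).  As n eps'
    exceeds a large multiple of log (1 / tau) + p log (p n), a union bound
    over a grid of (p n)^O(p) pairs (a, v) is affordable ([good_event]), and
    such a grid is fine enough to reach all pairs ([uniform_truncated]).

    These bounds allow a different set of outliers in each direction v; one
    subset good for all directions comes from a minimax argument
    ([exists_pruned_subset]).  Against a mixture of directions, one replaces
    the mixture by one random combination with random signs: a second moment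
    that is large on average over the mixture is large in the random direction
    with constant probability, so the truncated bounds carry over to mixtures
    ([mixture_truncated]).  Multiplicative weights exchange the quantifiers
    ([minimax_weights]), and fractional weights are rounded to a subset.

    Finally the filter succeeds with probability at least 1 - tau for each
    fixed sample in the good event, and integrating over the good event gives
    (1 - tau)^2 >= 1 - 2 tau, whether or not the estimator and the adversary
    are measurable ([product_measure_ge]). *)

Set Implicit Arguments.
Unset Strict Implicit.
Unset Printing Implicit Defensive.

Import Order.TTheory GRing.Theory Num.Theory.

Local Open Scope mset_scope.
Local Open Scope classical_set_scope.
Local Open Scope ring_scope.

(** * Euclidean vectors *)

Lemma dotvE (R : realType) p (u v : 'cV[R]_p) :
  dotv u v = \sum_i u i ord0 * v i ord0.
Proof. by rewrite /dotv !mxE; apply: eq_bigr => i _; rewrite !mxE. Qed.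

Lemma dotvC (R : realType) p (u v : 'cV[R]_p) : dotv u v = dotv v u.
Proof. by rewrite !dotvE; apply: eq_bigr => i _; rewrite mulrC. Qed.

Lemma dotvDr (R : realType) p (g u v : 'cV[R]_p) :
  dotv g (u + v) = dotv g u + dotv g v.
Proof. by rewrite /dotv mulmxDr mxE. Qed.

Lemma dotvNr (R : realType) p (g v : 'cV[R]_p) : dotv g (- v) = - dotv g v.
Proof. by rewrite /dotv mulmxN mxE. Qed.

Lemma dotvBr (R : realType) p (g u v : 'cV[R]_p) :
  dotv g (u - v) = dotv g u - dotv g v.
Proof. by rewrite dotvDr dotvNr. Qed.

Lemma dotvZr (R : realType) p (g v : 'cV[R]_p) a :
  dotv g (a *: v) = a * dotv g v.
Proof. by rewrite /dotv -scalemxAr mxE. Qed.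

Lemma dotvDl (R : realType) p (g u v : 'cV[R]_p) :
  dotv (u + v) g = dotv u g + dotv v g.
Proof. by rewrite dotvC dotvDr !(dotvC g). Qed.

Lemma dotvBl (R : realType) p (g u v : 'cV[R]_p) :
  dotv (u - v) g = dotv u g - dotv v g.
Proof. by rewrite dotvC dotvBr !(dotvC g). Qed.

Lemma dotvZl (R : realType) p (g v : 'cV[R]_p) a :
  dotv (a *: v) g = a * dotv v g.
Proof. by rewrite dotvC dotvZr dotvC. Qed.

Lemma dotv0r (R : realType) p (v : 'cV[R]_p) : dotv v 0 = 0.
Proof. by rewrite /dotv mulmx0 mxE. Qed.

Lemma dotv_suml (R : realType) p I (r : seq I) (P : pred I) (F : I -> 'cV[R]_p) v :
  dotv (\sum_(i <- r | P i) F i) v = \sum_(i <- r | P i) dotv (F i) v.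
Proof.
elim/big_rec2 : _ => [|i y1 y2 _ <-]; first by rewrite dotvC dotv0r.
by rewrite dotvDl.
Qed.

Lemma dotv_ge0 (R : realType) p (v : 'cV[R]_p) : 0 <= dotv v v.
Proof. by rewrite dotvE; apply: sumr_ge0 => i _; rewrite -expr2 sqr_ge0. Qed.

Lemma dotv_eq0 (R : realType) p (v : 'cV[R]_p) : dotv v v = 0 -> v = 0.
Proof.
rewrite dotvE => /eqP; rewrite psumr_eq0 => [|i _]; last by rewrite -expr2 sqr_ge0.
move=> /allP v0; apply/colP => i; rewrite mxE.
by have := v0 i (mem_index_enum _); rewrite mulf_eq0 orbb => /eqP.
Qed.

Lemma cauchy_schwarz (R : realType) p (u v : 'cV[R]_p) :
  dotv u v ^+ 2 <= dotv u u * dotv v v.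
Proof.
have [v0|v0] := eqVneq (dotv v v) 0.
  by rewrite (dotv_eq0 v0) !dotv0r mulr0 expr0n.
have vp : 0 < dotv v v by rewrite lt_def v0 dotv_ge0.
have := dotv_ge0 (dotv v v *: u - dotv u v *: v).
rewrite !(dotvBl, dotvBr, dotvZl, dotvZr) (dotvC v u) => H.
rewrite -(ler_pM2l vp) -subr_ge0; apply: le_trans H _.
rewrite le_eqVlt; apply/orP; left; apply/eqP; ring.
Qed.

Lemma norm2_sqr (R : realType) p (v : 'cV[R]_p) : norm2 v ^+ 2 = dotv v v.
Proof. by rewrite /norm2 sqr_sqrtr// dotv_ge0. Qed.

Lemma norm2_ge0 (R : realType) p (v : 'cV[R]_p) : 0 <= norm2 v.
Proof. exact: sqrtr_ge0. Qed.

(** * Random signs and mixtures of directions *)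

(** The expectation of [F] at [v] plus a sum of the entries of [l] with
    independent uniform signs.  Drawing the signs one at a time makes every
    moment computation an induction on [l]. *)
Fixpoint sign_avg (R : realType) (V : lmodType R) (l : seq V) (F : V -> R)
    (v : V) : R :=
  if l is w :: l' then (sign_avg l' F (v + w) + sign_avg l' F (v - w)) / 2
  else F v.

Lemma sign_avg_le (R : realType) (V : lmodType R) (l : seq V) (F G : V -> R) v :
  (forall u, F u <= G u) -> sign_avg l F v <= sign_avg l G v.
Proof.
move=> FG; elim: l v => [|w l IH] v //=.
by rewrite ler_pM2r ?invr_gt0// lerD.
Qed.

Lemma sign_avg_sum (R : realType) (V : lmodType R) (l : seq V) (I : finType)
    (F : I -> V -> R) v :
  sign_avg l (fun u => \sum_i F i u) v = \sum_i sign_avg l (F i) v.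
Proof.
elim: l v => [|w l IH] v //=.
by rewrite !IH -big_split/= mulr_suml.
Qed.

Lemma sign_avg_lin (R : realType) (V : lmodType R) (l : seq V) (F G : V -> R)
    a b v :
  sign_avg l (fun u => a * F u + b * G u) v
  = a * sign_avg l F v + b * sign_avg l G v.
Proof.
elim: l v => [|w l IH] v //=.
rewrite !IH.
move: (sign_avg l F _) (sign_avg l F _) (sign_avg l G _) (sign_avg l G _) => A B C' D.
ring.
Qed.

Lemma sign_avg_cst (R : realType) (V : lmodType R) (l : seq V) (c : R) v :
  sign_avg l (fun=> c) v = c.
Proof. by elim: l v => [|w l IH] v //=; rewrite !IH; lra. Qed.

Lemma sign_avg_norm (R : realType) p (l : seq 'cV[R]_p) v :
  sign_avg l (fun u => dotv u u) v = dotv v v + \sum_(w <- l) dotv w w.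
Proof.
elim: l v => [|w l IH] v /=; first by rewrite big_nil addr0.
rewrite !IH big_cons !(dotvBl, dotvBr, dotvDl, dotvDr) (dotvC w v).
by lra.
Qed.

Lemma sign_avg_sqr (R : realType) p (l : seq 'cV[R]_p) g v :
  sign_avg l (fun u => dotv g u ^+ 2) v
  = dotv g v ^+ 2 + \sum_(w <- l) dotv g w ^+ 2.
Proof.
elim: l v => [|w l IH] v /=; first by rewrite big_nil addr0.
by rewrite !IH big_cons !(dotvBr, dotvDr); lra.
Qed.

(** Khintchine's inequality for the fourth moment; the term in [dotv g v]
    is what makes the induction on [l] go through. *)
Lemma sign_avg_pow4 (R : realType) p (l : seq 'cV[R]_p) g v :
  sign_avg l (fun u => dotv g u ^+ 4) v
  <= dotv g v ^+ 4 + 6 * dotv g v ^+ 2 * \sum_(w <- l) dotv g w ^+ 2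
     + 3 * (\sum_(w <- l) dotv g w ^+ 2) ^+ 2.
Proof.
elim: l v => [|w l IH] v /=; first by rewrite big_nil mulr0 expr0n/= mulr0 !addr0.
rewrite big_cons.
set S := \sum_(_ <- l) _ in IH *.
have := IH (v + w); have := IH (v - w).
rewrite dotvBr dotvDr.
move: (dotv g v) (dotv g w) (sign_avg _ _ _) (sign_avg _ _ _) => a b X Y hX hY.
rewrite ler_pdivrMr//; apply: le_trans (lerD hY hX) _.
rewrite -subr_ge0.
have -> : (a ^+ 4 + 6 * a ^+ 2 * (b ^+ 2 + S) + 3 * (b ^+ 2 + S) ^+ 2) * 2 -
  ((a + b) ^+ 4 + 6 * (a + b) ^+ 2 * S + 3 * S ^+ 2 +
   ((a - b) ^+ 4 + 6 * (a - b) ^+ 2 * S + 3 * S ^+ 2)) = 4 * (b ^+ 2) ^+ 2 by ring.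
by rewrite mulr_ge0// sqr_ge0.
Qed.

(** A Paley-Zygmund inequality for the truncated square.  The truncation is
    bounded below by a polynomial, min(y, 1) >= t y - (t y)^2 / 4 for t <= 1,
    whose average the second and fourth moments control; t = min(1, 1 / rho)
    is the best choice. *)
Lemma sign_avg_min (R : realType) p (l : seq 'cV[R]_p) g :
  Num.min (\sum_(w <- l) dotv g w ^+ 2) 1
  <= 4 * sign_avg l (fun u => Num.min (dotv g u ^+ 2) 1) 0.
Proof.
set rho := \sum_(w <- l) _.
have rho0 : 0 <= rho by apply: sumr_ge0 => w _; rewrite sqr_ge0.
have key (t : R) : 0 <= t -> t <= 1 ->
  t * rho - 3 / 4 * (t * rho) ^+ 2
  <= sign_avg l (fun u => Num.min (dotv g u ^+ 2) 1) 0.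
  move=> t0 t1.
  apply: (@le_trans _ _ (sign_avg l
     (fun u => t * dotv g u ^+ 2 + (- (t ^+ 2 / 4)) * dotv g u ^+ 4) 0)).
    rewrite sign_avg_lin sign_avg_sqr dotv0r expr0n/= add0r -/rho.
    have := sign_avg_pow4 l g 0.
    rewrite dotv0r !expr0n/= add0r mulr0 mul0r add0r -/rho.
    set Z := sign_avg _ _ _ => hZ.
    have : t ^+ 2 / 4 * Z <= t ^+ 2 / 4 * (3 * rho ^+ 2).
      by rewrite ler_wpM2l// divr_ge0// sqr_ge0.
    by rewrite exprMn; lra.
  apply: sign_avg_le => u.
  have -> : dotv g u ^+ 4 = (dotv g u ^+ 2) ^+ 2 by rewrite -exprM.
  move: (dotv g u ^+ 2) (sqr_ge0 (dotv g u)) => y y0.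
  rewrite le_min; apply/andP; split; first by nra.
  have : 0 <= (t * y / 2 - 1) ^+ 2 by rewrite sqr_ge0.
  by nra.
have [r1|r1] := leP rho 1.
  by have := key 1 ler01 (lexx _); rewrite mul1r; nra.
have rp : 0 < rho by apply: lt_trans r1.
have := key rho^-1 _ _; rewrite mulVf ?gt_eqF// => /(_ _ _).
rewrite invr_ge0 rho0 invf_le1// ltW// => /(_ isT isT).
by rewrite expr1n; lra.
Qed.

(** The entries [w] of [l] stand for sqrt q_k v_k, where the directions v_k are
    mixed with weights q_k.  Their signed sum has mean square norm at most 1,
    so it is on average an admissible direction for the hypothesis, whatever
    its actual norm: the truncated sum grows at most like the square of the
    norm. *)
Lemma mixture_truncated (R : realType) p (I : finType) (g : I -> 'cV[R]_p) (s : R)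
    (l : seq 'cV[R]_p) :
  (forall v, dotv v v <= 1 -> \sum_i Num.min (dotv (g i) v ^+ 2) 1 <= s) ->
  \sum_(w <- l) dotv w w <= 1 ->
  \sum_i Num.min (\sum_(w <- l) dotv (g i) w ^+ 2) 1 <= 8 * s.
Proof.
move=> hs hl.
have s0 : 0 <= s.
  apply: le_trans (hs 0 _); last by rewrite dotv0r ler01.
  by apply: sumr_ge0 => i _; rewrite le_min sqr_ge0 ler01.
have hv v : \sum_i Num.min (dotv (g i) v ^+ 2) 1 <= s * 1 + s * dotv v v.
  have [v1|v1] := leP (dotv v v) 1.
    by apply: le_trans (hs _ v1) _; rewrite mulr1 lerDl mulr_ge0// dotv_ge0.
  have vp : 0 < dotv v v by apply: lt_trans v1.
  have np : 0 < norm2 v by rewrite sqrtr_gt0.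
  have h1 : dotv ((norm2 v)^-1 *: v) ((norm2 v)^-1 *: v) <= 1.
    by rewrite dotvZl dotvZr mulrA -expr2 exprVn norm2_sqr mulVf ?gt_eqF.
  have := hs _ h1; rewrite -(ler_pM2l vp) => h2.
  apply: (@le_trans _ _ (dotv v v * s)); last by rewrite mulr1 (mulrC s) lerDr.
  apply: le_trans h2; rewrite mulr_sumr; apply: ler_sum => i _.
  rewrite dotvZr exprMn exprVn norm2_sqr minr_pMr ?(ltW vp)// mulrA mulfV ?gt_eqF// mul1r mulr1.
  by rewrite le_min !ge_min lexx/= (ltW v1) orbT.
apply: (@le_trans _ _ (\sum_i 4 * sign_avg l (fun u => Num.min (dotv (g i) u ^+ 2) 1) 0)).
  by apply: ler_sum => i _; exact: sign_avg_min.
rewrite -mulr_sumr -sign_avg_sum.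
have := sign_avg_le l 0 hv.
rewrite sign_avg_lin sign_avg_cst sign_avg_norm dotv0r add0r.
by nra.
Qed.

(** * Multiplicative weights *)

Lemma expR_half_le (R : realType) (x : R) : 0 <= x -> x <= 1 ->
  expR (x / 2) <= 1 + x.
Proof.
move=> x0 x1.
have h : expR (x / 2) * (1 - x / 2) <= 1.
  have := expR_ge1Dx (- (x / 2)); rewrite expRN => h.
  rewrite -(@ler_pM2r _ (expR (x / 2))^-1) ?invr_gt0 ?expR_gt0//.
  by rewrite mulrAC mulfV ?gt_eqF ?expR_gt0// !mul1r; lra.
have := expR_gt0 (x / 2).
by nra.
Qed.

(** A two-player game: one player assigns weights in [0, 1] to the indices,
    removing a total mass of at most [c], and the other picks a column [v].
    [response] says that every mixed strategy [q] of the second player is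
    answered by keeping the indices whose mixed value is at most 1. *)
Section multiplicative_weights.
Context (R : realType) (I V : finType) (f : I -> V -> R) (c : R).
Hypotheses (f0 : forall i v, 0 <= f i v) (c0 : 0 < c).
Hypothesis response : forall q : V -> R, (forall v, 0 <= q v) -> \sum_v q v = 1 ->
  \sum_i Num.min (\sum_v q v * f i v) 1 <= c.

Let F := 1 + \sum_i \sum_v f i v.

Let F_gt0 : 0 < F.
Proof.
by rewrite ltr_pwDl// sumr_ge0// => i _; rewrite sumr_ge0.
Qed.

Let le_F v : \sum_i f i v <= F.
Proof.
rewrite /F -[leLHS]add0r lerD ?ler01// ler_sum// => i _.
by rewrite (bigD1 v)//= lerDl sumr_ge0.
Qed.

(** After [t] rounds, [S] is the sum of the responses played and [W] the
    weights of the second player, each of which is multiplied by one plus the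
    normalized loss in every round.  The two exponential bounds on [W] say
    that no column has lost much more than [c] per round. *)
Lemma multiplicative_update (w0 : V) (t : nat) : exists (S : I -> R) (W : V -> R),
  [/\ forall i, 0 <= S i <= t%:R,
      \sum_i (t%:R - S i) <= c * t%:R,
      forall v, expR ((\sum_i S i * f i v) / F / 2) <= W v &
      \sum_v W v <= #|V|%:R * expR (c / F * t%:R)].
Proof.
elim: t => [|t [S [W [hS hS2 hW hW2]]]].
  exists (fun=> 0), (fun=> 1); split.
  - by move=> i; rewrite lexx.
  - by rewrite big1 ?mulr0// => i _; rewrite subr0.
  - by move=> v; rewrite big1 ?mul0r ?expR0// => i _; rewrite mul0r.
  - by rewrite mulr0 expR0 sumr_const mulr1.
have W0 v : 0 < W v by apply: lt_le_trans (hW v); rewrite expR_gt0.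
pose Z := \sum_v W v.
have Z0 : 0 < Z by rewrite /Z (bigD1 w0)//= ltr_pwDl// sumr_ge0// => v _; rewrite ltW.
pose rho i := \sum_v W v / Z * f i v.
have rho0 i : 0 <= rho i by rewrite sumr_ge0// => v _; rewrite mulr_ge0// divr_ge0// ltW.
have hrho : \sum_i Num.min (rho i) 1 <= c.
  apply: response => [v|]; first by rewrite divr_ge0// ltW.
  by rewrite -mulr_suml mulfV ?gt_eqF.
pose a i : R := (rho i <= 1)%R%:R.
have a01 i : 0 <= a i <= 1 by rewrite /a ler0n lern1 leq_b1.
exists (fun i => S i + a i).  exists (fun v => W v * (1 + (\sum_i a i * f i v) / F)); split.
- move=> i; have /andP[? ?] := hS i; have /andP[? ?] := a01 i.
  by rewrite addr_ge0//= -natr1 lerD.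
- rewrite -natr1 mulrDr mulr1.
  apply: le_trans (lerD hS2 hrho); rewrite -big_split/=; apply: ler_sum => i _.
  have := rho0 i; rewrite /a; case: (leP (rho i) 1) => h r0.
    by rewrite /= mulr1n; lra.
  by rewrite /= mulr0n; lra.
- move=> v; rewrite (eq_bigr (fun i => S i * f i v + a i * f i v)); last first.
    by move=> i _; rewrite mulrDl.
  rewrite big_split/= !mulrDl expRD ler_pM ?expR_ge0//.
  apply: expR_half_le; first by rewrite divr_ge0 ?(ltW F_gt0)// sumr_ge0// => i _;
    have /andP[? ?] := a01 i; rewrite mulr_ge0.
  rewrite ler_pdivrMr// mul1r; apply: le_trans (le_F v); apply: ler_sum => i _.
  by have /andP[? ?] := a01 i; rewrite ler_piMl.
- have -> : \sum_v W v * (1 + (\sum_i a i * f i v) / F)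
      = Z * (1 + (\sum_i a i * rho i) / F).
    have -> : \sum_v W v * (1 + (\sum_i a i * f i v) / F)
       = Z + (\sum_v \sum_i W v * (a i * f i v)) / F.
      rewrite /Z mulr_suml -big_split/=; apply: eq_bigr => v _.
      by rewrite -mulr_sumr; ring.
    rewrite exchange_big/= mulrDr mulr1; congr (_ + _).
    rewrite mulrA; congr (_ / _); rewrite mulr_sumr; apply: eq_bigr => i _.
    rewrite /rho mulr_sumr mulr_sumr; apply: eq_bigr => v _.
    have -> : Z * (a i * (W v / Z * f i v)) = (Z / Z) * (W v * (a i * f i v)) by ring.
    by rewrite divff ?gt_eqF// mul1r.
  rewrite -natr1 [c / F * _]mulrDr mulr1 expRD mulrA ler_pM//; first exact: ltW.
    rewrite addr_ge0// divr_ge0 ?(ltW F_gt0)// sumr_ge0// => i _.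
    by have /andP[? ?] := a01 i; rewrite mulr_ge0.
  apply: le_trans (expR_ge1Dx _); rewrite lerD2l ler_pM2r ?invr_gt0//.
  apply: le_trans hrho; apply: ler_sum => i _; rewrite /a.
  by case: (leP (rho i) 1) => h; rewrite ?mul1r ?mul0r.
Qed.

(** The average of the responses over [t] rounds; the regret is of order
    #|V| / t and disappears in a factor 3 once [t] is large. *)
Lemma minimax_weights : exists a : I -> R,
  [/\ forall i, 0 <= a i <= 1, \sum_i (1 - a i) <= c &
      forall v, \sum_i a i * f i v <= 3 * c].
Proof.
have [w0 _|V0] := pickP V; last first.
  exists (fun=> 1); split => [i|| v]; first by rewrite ler01 lexx.
    by rewrite big1 ?ltW// => i _; rewrite subrr.
  by have := V0 v.
(* Enough rounds for the regret, 2 F #|V| / t, to drop below c. *)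
pose t := (Num.truncn (2 * F * #|V|%:R / c)).+1.
have t0 : 0 < t%:R :> R by rewrite ltr0n.
have ht : 2 * F * #|V|%:R <= c * t%:R.
  by rewrite [c * _]mulrC -ler_pdivrMr//; apply/ltW; exact: truncnS_gt.
have [S [W [hS hS2 hW hW2]]] := multiplicative_update w0 t.
have W0 v : 0 < W v by apply: lt_le_trans (hW v); rewrite expR_gt0.
exists (fun i => S i / t%:R); split.
- move=> i; have /andP[S0 S1] := hS i.
  by rewrite divr_ge0 ?(ltW t0)//= ler_pdivrMr// mul1r.
- rewrite (eq_bigr (fun i => (t%:R - S i) / t%:R)) => [|i _]; last first.
    by rewrite mulrBl divff ?gt_eqF.
  by rewrite -mulr_suml ler_pdivrMr.
- move=> v; rewrite (eq_bigr (fun i => (S i * f i v) / t%:R)) => [|i _]; last first.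
    by rewrite mulrAC.
  rewrite -mulr_suml ler_pdivrMr//.
  have : expR ((\sum_i S i * f i v) / F / 2) <= expR (#|V|%:R + c / F * t%:R).
    apply: le_trans (hW v) _; apply: (@le_trans _ _ (\sum_v W v)).
      by rewrite (bigD1 v)//= lerDl sumr_ge0// => u _; rewrite ltW.
    apply: le_trans hW2 _; rewrite expRD ler_wpM2r ?expR_ge0//.
    by apply: le_trans (expR_ge1Dx _); rewrite lerDr.
  rewrite ler_expR ler_pdivrMr// ler_pdivrMr// => /le_trans; apply.
  have -> : (#|V|%:R + c / F * t%:R) * 2 * F = 2 * F * #|V|%:R + 2 * c * t%:R * (F / F) by ring.
  rewrite divff ?gt_eqF// mulr1.
  by lra.
Qed.

End multiplicative_weights.

(** * A grid in the unit ball *)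

(** Coordinates are a sign and a multiple of 1 / N.  Grid points outside the
    unit ball are sent to 0, so that every value of [ball_grid] is an
    admissible direction. *)
Definition ball_grid (R : realType) (p N : nat)
    (k : {ffun 'I_p -> bool * 'I_N.+1}) : 'cV[R]_p :=
  let v := \col_j ((-1) ^+ (k j).1 * (k j).2%:R / N%:R) in
  if dotv v v <= 1 then v else 0.

Lemma ball_grid_le1 (R : realType) p N k :
  dotv (@ball_grid R p N k) (ball_grid R k) <= 1.
Proof. by rewrite /ball_grid; case: ifP => // _; rewrite dotv0r ler01. Qed.

(** Each coordinate is rounded toward 0, which keeps the rounded vector in the
    ball. *)
Lemma ball_grid_approx (R : realType) p N (v : 'cV[R]_p) :
  (0 < N)%N -> dotv v v <= 1 ->
  exists k, dotv (v - @ball_grid R p N k) (v - ball_grid R k) <= p%:R / N%:R ^+ 2.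
Proof.
move=> N0 v1.
have NR : 0 < N%:R :> R by rewrite ltr0n.
have vj j : `|v j ord0| <= 1.
  rewrite -(@expr_le1 _ 2)// real_normK ?num_real//; apply: le_trans v1.
  by rewrite dotvE (bigD1 j)//= -expr2 lerDl sumr_ge0// => i _; rewrite -expr2 sqr_ge0.
pose m j := Num.truncn (N%:R * `|v j ord0|).
have m0 j : 0 <= N%:R * `|v j ord0| by rewrite mulr_ge0 ?ler0n.
have mN j : (m j < N.+1)%N.
  rewrite ltnS -(ler_nat R); apply: (@le_trans _ _ (N%:R * `|v j ord0|)).
    by rewrite truncn_le.
  by rewrite ler_piMr ?ler0n.
pose k := [ffun j => (v j ord0 < 0, Ordinal (mN j))].
pose u : 'cV[R]_p := \col_j ((-1) ^+ (k j).1 * (k j).2%:R / N%:R).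
have uE j : u j ord0 = (-1) ^+ (v j ord0 < 0)%R * ((m j)%:R / N%:R).
  by rewrite mxE ffunE/= mulrA.
have vE j : v j ord0 = (-1) ^+ (v j ord0 < 0)%R * `|v j ord0|.
  exact: realEsign (num_real _).
have um j : (0 : R) <= (m j)%:R / N%:R <= `|v j ord0|.
  rewrite divr_ge0 ?ler0n//= ler_pdivrMr// mulrC.
  by rewrite truncn_le.
have um2 j : `|v j ord0| - (m j)%:R / N%:R <= N%:R^-1.
  rewrite lerBlDr -(ler_pM2l NR) mulrDr mulfV ?gt_eqF// mulrCA divff ?gt_eqF// mulr1.
  by rewrite addrC natr1; apply/ltW; exact: truncnS_gt.
have u1 : dotv u u <= 1.
  apply: le_trans v1; rewrite !dotvE; apply: ler_sum => j _.
  rewrite -!expr2 uE [in leRHS]vE [leLHS]exprMn [leRHS]exprMn ler_wpM2l ?sqr_ge0//.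
  have /andP[? ?] := um j; by rewrite ler_sqr ?nnegrE.
exists k; rewrite /ball_grid -/u u1 dotvE.
apply: (@le_trans _ _ (\sum_(j < p) N%:R^-1 ^+ 2)); last first.
  by rewrite sumr_const card_ord exprVn -[leLHS]mulr_natl.
apply: ler_sum => j _.
have -> : (v - u) j ord0 = (-1) ^+ (v j ord0 < 0)%R * (`|v j ord0| - (m j)%:R / N%:R).
  by rewrite !mxE/= -/(u j ord0) mulrBr -vE !ffunE/= mulrA.
rewrite -expr2 exprMn sqrr_sign mul1r ler_sqr ?nnegrE ?invr_ge0 ?ler0n//.
by have /andP[_ ?] := um j; rewrite subr_ge0.
Qed.

(** * Pruning a family of vectors *)

Definition clip (R : realType) (y : R) : R := Num.max (-1) (Num.min y 1).

Lemma clipP (R : realType) (y : R) :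
  [\/ y < -1 /\ clip y = -1, -1 <= y <= 1 /\ clip y = y | 1 < y /\ clip y = 1].
Proof.
rewrite /clip; have [h|h] := leP y 1.
  have [h'|h'] := leP (-1) y; last by constructor 1.
  by constructor 2.
by constructor 3; split=> //; have [//|] := leP (-1 : R) 1; lra.
Qed.

Lemma clip_le1 (R : realType) (y : R) : `|clip y| <= 1.
Proof. by rewrite ler_norml; case: (clipP y) => -[h ->]; lra. Qed.

Lemma clip_diff (R : realType) (y : R) : `|y - clip y| <= y ^+ 2.
Proof. by rewrite ler_norml; case: (clipP y) => -[h ->]; apply/andP; split; nra. Qed.

Lemma clip_lipschitz (R : realType) (x y : R) : `|clip x - clip y| <= `|x - y|.
Proof.
by rewrite ler_norml; case: (clipP x) => -[hx ->]; case: (clipP y) => -[hy ->];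
  case: (ler0P (x - y)) => h; lra.
Qed.

(** Second moments: the grid makes the set of directions finite, so that
    [minimax_weights] applies, and keeping the indices of weight at least 1 / 2
    at most doubles the bounds.  The grid is chosen after the vectors [g], and
    its size does not enter the conclusion.

    First moments: the clipped sum over all indices is small, removing an
    index changes it by at most 1, and undoing the clipping on the kept
    indices costs at most their second moment. *)
Lemma exists_pruned_subset (R : realType) p (I : finType) (g : I -> 'cV[R]_p) (s : R) : 0 < s ->
  (forall v, dotv v v <= 1 -> \sum_i Num.min (dotv (g i) v ^+ 2) 1 <= s) ->
  (forall v, dotv v v <= 1 -> `|\sum_i clip (dotv (g i) v)| <= s) ->
  exists J : {set I}, #|~: J|%:R <= 16 * s /\
    forall v, dotv v v <= 1 -> \sum_(i in J) dotv (g i) v ^+ 2 <= 100 * s /\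
      `|\sum_(i in J) dotv (g i) v| <= 117 * s.
Proof.
move=> s0 h2 h1.
pose G := \sum_i dotv (g i) (g i).
have G0 : 0 <= G by apply: sumr_ge0 => i _; exact: dotv_ge0.
(* Fine enough for rounding a direction to cost at most s in total. *)
pose N := (Num.truncn (2 * G * p%:R / s)).+1.
have N1 : 1 <= N%:R :> R by rewrite ler1n.
have NR : 0 < N%:R :> R by rewrite ltr0n.
have hN : 2 * G * (p%:R / N%:R ^+ 2) <= s.
  have hN1 : 2 * G * p%:R <= N%:R * s.
    by rewrite -ler_pdivrMr//; apply/ltW; exact: truncnS_gt.
  rewrite mulrA ler_pdivrMr ?exprn_gt0//; apply: le_trans hN1 _.
  by rewrite mulrC ler_pM2l// expr2 ler_peMr ?ler0n.
pose f i k := dotv (g i) (@ball_grid R p N k) ^+ 2.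
have [||q q0 q1|a [a01 ha1 ha2]] := @minimax_weights R I _ f (8 * s).
- by move=> i v; rewrite sqr_ge0.
- by rewrite mulr_gt0.
- pose w k : 'cV[R]_p := Num.sqrt (q k) *: ball_grid R k.
  have := @mixture_truncated R p I g s [seq w k | k <- index_enum _] h2.
  rewrite big_map => H.
  apply: le_trans (H _); last first.
    rewrite -q1; apply: ler_sum => k _.
    rewrite /w dotvZl dotvZr mulrA -expr2 sqr_sqrtr//.
    by rewrite ler_piMr// ball_grid_le1.
  apply: ler_sum => i _; rewrite big_map le_eqVlt; apply/orP; left; apply/eqP.
  congr Num.min; apply: eq_bigr => k _.
  by rewrite /w dotvZr exprMn sqr_sqrtr.
pose J := [set i | 1 / 2 <= a i]%SET.
have hJ : #|~: J|%:R <= 16 * s.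
  rewrite -sum1_card natr_sum.
  apply: (@le_trans _ _ (\sum_(i in ~: J) 2 * (1 - a i))).
    by apply: ler_sum => i; rewrite !inE -ltNge => ?; lra.
  apply: (@le_trans _ _ (\sum_i 2 * (1 - a i))); last by rewrite -mulr_sumr; lra.
  rewrite [leRHS](bigID (mem (~: J)))/= lerDl sumr_ge0// => i _.
  by have /andP[? ?] := a01 i; lra.
have hq v : dotv v v <= 1 -> \sum_(i in J) dotv (g i) v ^+ 2 <= 100 * s.
  move=> v1.
  have [|k hk] := @ball_grid_approx R p N v _ v1; first by [].
  set u := ball_grid R k in hk.
  have hi i : a i * dotv (g i) v ^+ 2 <= 2 * (a i * f i k) + 2 * (dotv (g i) (g i) * (p%:R / N%:R ^+ 2)).
    have /andP[a0 a1] := a01 i.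
    have := cauchy_schwarz (g i) (v - u); rewrite dotvBr => cs.
    have : (dotv (g i) v - dotv (g i) u) ^+ 2 <= dotv (g i) (g i) * (p%:R / N%:R ^+ 2).
      by apply: le_trans cs _; rewrite ler_wpM2l// dotv_ge0.
    rewrite /f -/u; move: (_ * (p%:R / _)) (dotv (g i) v) (dotv (g i) u) => E x y hE.
    have hxy : x ^+ 2 <= 2 * y ^+ 2 + 2 * (x - y) ^+ 2.
      by rewrite -subr_ge0; apply: le_trans (sqr_ge0 (x - 2 * y)) _; rewrite le_eqVlt; apply/orP; left; apply/eqP; ring.
    have E0 : 0 <= E by apply: le_trans hE; rewrite sqr_ge0.
    have := ler_wpM2l a0 hxy.
    have := ler_wpM2l a0 hE.
    have := ler_wpM2r E0 a1.
    by lra.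
  have H : \sum_i a i * dotv (g i) v ^+ 2 <= 49 * s.
    apply: le_trans (ler_sum _ (fun i _ => hi i)) _.
    rewrite big_split/= -!mulr_sumr -mulr_suml -/G mulrA.
    by have := ha2 k; lra.
  apply: (@le_trans _ _ (\sum_i 2 * (a i * dotv (g i) v ^+ 2))); last first.
    by rewrite -mulr_sumr; lra.
  rewrite [leRHS](bigID (mem J))/= -[leLHS]addr0 lerD//.
    apply: ler_sum => i; rewrite inE => ?.
    have := sqr_ge0 (dotv (g i) v); nra.
  by rewrite sumr_ge0// => i _; have /andP[a0 _] := a01 i; do 2 apply: mulr_ge0 => //; rewrite sqr_ge0.
exists J; split=> // v v1; split; first exact: hq.
have -> : \sum_(i in J) dotv (g i) v = \sum_i clip (dotv (g i) v)
    - \sum_(i in ~: J) clip (dotv (g i) v)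
    + \sum_(i in J) (dotv (g i) v - clip (dotv (g i) v)).
  rewrite [\sum_i _](bigID (mem J))/= sumrB.
  have -> : \sum_(i in ~: J) clip (dotv (g i) v) = \sum_(i | i \notin J) clip (dotv (g i) v).
    by apply: eq_bigl => i; rewrite inE.
  by ring.
apply: le_trans (ler_normD _ _) _.
apply: (@le_trans _ _ ((s + 16 * s) + 100 * s)); last by lra.
apply: lerD; last first.
  apply: le_trans (ler_norm_sum _ _ _) _; apply: le_trans (hq _ v1).
  by apply: ler_sum => i _; exact: clip_diff.
apply: le_trans (ler_normB _ _) _; apply: lerD; first exact: h1.
apply: le_trans (ler_norm_sum _ _ _) _; apply: le_trans hJ.
rewrite -sum1_card natr_sum; apply: ler_sum => i _; exact: clip_le1.
Qed.

(** * Multisets and corruption *)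

Lemma msubset_subseq (X : choiceType) (A : {mset X}) (s : seq X) :
  (A `<=` seq_mset s)%mset -> exists2 t, subseq t s & perm_eq A t.
Proof.
move=> /msubsetP AS; apply/count_subseqP => x.
have := AS x; rewrite mset_seqE => h; apply: leq_trans h.
by rewrite -mset_seqE seq_mset_id.
Qed.

Lemma msubset_size (X : choiceType) (A B : {mset X}) :
  (A `<=` B)%mset -> (size A <= size B)%N.
Proof.
rewrite -{1}(seq_mset_id B) => /msubset_subseq[t tB At].
by rewrite (perm_size At) size_subseq.
Qed.

Lemma msubset_map (X Y : choiceType) (f : X -> Y) (A B : {mset X}) :
  (A `<=` B)%mset -> (seq_mset (map f A) `<=` seq_mset (map f B))%mset.
Proof.
rewrite -{1}(seq_mset_id B) => /msubset_subseq[t tB At].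
apply/msubsetP => y; rewrite !mset_seqE.
rewrite (permP (perm_map f At)).
by apply/leq_count_subseq/map_subseq.
Qed.

Lemma corrupted_map (R : realType) (X Y : choiceType) (f : X -> Y) (eps : R)
    (S T : {mset X}) :
  corrupted eps S T -> corrupted eps (seq_mset (map f S)) (seq_mset (map f T)).
Proof.
have sz (U : {mset X}) : size (seq_mset (map f U)) = size U.
  by rewrite (perm_size (perm_eq_seq_mset _)) size_map.
move=> [ST h]; split; rewrite !sz//; apply: le_trans h _.
rewrite ler_nat -sz; apply: msubset_size; apply/msubsetIP; split;
  apply: msubset_map; [exact: msubsetIl|exact: msubsetIr].
Qed.

Lemma corrupted_le (R : realType) (X : choiceType) (e e' : R) (S T : {mset X}) :
  e <= e' -> corrupted e S T -> corrupted e' S T.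
Proof.
move=> ee [ST h]; split=> //; apply: le_trans h.
by rewrite ler_wpM2r ?ler0n// lerD2l lerN2.
Qed.

(** * Stability of a pruned family *)

(** Norms are always bounded by testing against unit vectors; the vector
    tested is u / |u|. *)
Lemma norm2_dual (R : realType) p (u : 'cV[R]_p) (c : R) :
  (forall v, dotv v v <= 1 -> dotv u v <= c) -> norm2 u <= c.
Proof.
move=> h; have [u0|u0] := eqVneq (norm2 u) 0.
  by rewrite u0; have := h 0; rewrite !dotv0r; apply; exact: ler01.
have up : 0 < norm2 u by rewrite lt_def u0 norm2_ge0.
have := h ((norm2 u)^-1 *: u); rewrite dotvZl !dotvZr -norm2_sqr expr2.
by rewrite mulKf// mulVf// lexx; apply.
Qed.

Lemma sum_sqr_le (R : realType) (I : finType) (K : {set I}) (F : I -> R) :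
  (\sum_(i in K) F i) ^+ 2 <= #|K|%:R * \sum_(i in K) F i ^+ 2.
Proof.
have [->|[k0 k0K]] := set_0Vmem K; first by rewrite !big_set0 expr0n mulr0.
have K0 : 0 < #|K|%:R :> R by rewrite ltr0n card_gt0; apply/set0Pn; exists k0.
set m := \sum_(i in K) F i.
have : 0 <= \sum_(i in K) (#|K|%:R * F i - m) ^+ 2.
  by apply: sumr_ge0 => i _; rewrite sqr_ge0.
have -> : \sum_(i in K) (#|K|%:R * F i - m) ^+ 2
  = #|K|%:R * (#|K|%:R * \sum_(i in K) F i ^+ 2 - m ^+ 2).
  rewrite (eq_bigr (fun i => #|K|%:R ^+ 2 * F i ^+ 2 +
     (- (2 * #|K|%:R * m)) * F i + m ^+ 2)) => [|i _]; last by ring.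
  rewrite !big_split/= -!mulr_sumr sumr_const -/m -[_ *+ _]mulr_natl.
  by ring.
by rewrite pmulr_rge0// subr_ge0.
Qed.

(** A large subset with bounded second moments and small mean stays so after
    the removal of a fraction [e] of its points: second moments can only
    decrease, and by Cauchy-Schwarz the removed points move the sum by at most
    n sqrt (e Lam).  The covariance condition reduces to an upper bound on second
    moments because [delta_quad] makes the allowed error exceed sigma^2 by
    enough. *)
Section stability.
Context (R : realType) (p n : nat) (pt h : 'I_n -> 'cV[R]_p) (mu : 'cV[R]_p).
Context (sigma Lam bet e delta : R) (J : {set 'I_n}).
Hypotheses (n0 : (0 < n)%N) (p0 : (0 < p)%N) (sigma0 : 0 <= sigma).
Hypotheses (e0 : 0 < e) (e2 : e < 1 / 2) (ed : e <= delta) (Lam0 : 0 <= Lam).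
Hypothesis ptE : forall i, pt i = mu + sigma *: h i.
Hypothesis Jbig : (n%:R : R) <= 2 * #|J|%:R.
Hypothesis quad : forall v, dotv v v <= 1 ->
  \sum_(i in J) dotv (h i) v ^+ 2 <= Lam * n%:R.
Hypothesis lin : forall v, dotv v v <= 1 ->
  `|\sum_(i in J) dotv (h i) v| <= bet * n%:R.
Hypothesis delta_lin : 4 * (bet + Num.sqrt (e * Lam)) <= delta.
Hypothesis delta_quad : (4 * Lam + 1) * e <= delta ^+ 2.

Let nR : 0 < n%:R :> R. Proof. by rewrite ltr0n. Qed.

Lemma subset_quad (L : {set 'I_n}) v w : L \subset J -> dotv v v <= 1 ->
  dotv w w <= 1 ->
  `|\sum_(i in L) dotv (h i) v * dotv (h i) w| <= Lam * n%:R.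
Proof.
move=> LJ v1 w1; apply: le_trans (ler_norm_sum _ _ _) _.
apply: (@le_trans _ _ (\sum_(i in J) (dotv (h i) v ^+ 2 / 2 + dotv (h i) w ^+ 2 / 2))).
  rewrite [leRHS](bigID (mem L))/= -[leLHS]addr0; apply: lerD.
    rewrite [leRHS](eq_bigl (mem L)) => [|i]; last first.
      by apply: andb_idl => iL; exact: (fintype.subsetP LJ).
    apply: ler_sum => i _; rewrite ler_norml.
    move: (dotv _ v) (dotv _ w) => x y.
    have := sqr_ge0 (x - y); have := sqr_ge0 (x + y).
    by move=> ? ?; apply/andP; split; nra.
  by apply: sumr_ge0 => i _; rewrite addr_ge0// divr_ge0// sqr_ge0.
by rewrite big_split/= -!mulr_suml; have := quad v1; have := quad w1; lra.
Qed.

Lemma subset_lin (L : {set 'I_n}) v : L \subset J ->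
  (1 - e) * #|J|%:R <= #|L|%:R -> dotv v v <= 1 ->
  \sum_(i in L) dotv (h i) v <= (bet + Num.sqrt (e * Lam)) * n%:R.
Proof.
move=> LJ hL v1.
have JD : #|J :\: L|%:R <= e * n%:R.
  have : #|L|%:R + #|J :\: L|%:R = #|J|%:R :> R.
    by rewrite -natrD -(cardsID L J) (finset.setIidPr LJ).
  have : #|J|%:R <= n%:R :> R by rewrite ler_nat -[leqRHS]card_ord max_card.
  by move=> /(ler_wpM2l (ltW e0)); lra.
have D2 : (\sum_(i in J :\: L) dotv (h i) v) ^+ 2 <= (Num.sqrt (e * Lam) * n%:R) ^+ 2.
  apply: le_trans (sum_sqr_le _ _) _.
  rewrite exprMn sqr_sqrtr ?mulr_ge0 ?(ltW e0)//.
  have -> : e * Lam * n%:R ^+ 2 = (e * n%:R) * (Lam * n%:R) by ring.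
  apply: ler_pM => //; first by apply: sumr_ge0 => i _; rewrite sqr_ge0.
  rewrite (eq_bigr (fun i => dotv (h i) v * dotv (h i) v)) => [|i _]; last by rewrite expr2.
  by apply: le_trans (ler_norm _) _; apply: subset_quad => //; exact: finset.subsetDl.
have := lin v1; rewrite (big_setID L)/= (finset.setIidPr LJ) ler_norml => /andP[_ h1].
have s0 : 0 <= Num.sqrt (e * Lam) * n%:R by rewrite mulr_ge0 ?sqrtr_ge0 ?ler0n.
move: D2; rewrite -[leLHS]real_normK ?num_real// ler_sqr ?nnegrE//.
by rewrite ler_norml => /andP[? _]; lra.
Qed.

Lemma stable_image : stable e delta (seq_mset [seq pt i | i <- enum J]) mu sigma.
Proof.
split=> // S' S'S; rewrite (perm_size (perm_eq_seq_mset _)) size_map -cardE => hS.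
have [t tS St] := msubset_subseq S'S.
have /subseqP[m _ tE] := tS.
rewrite -map_mask in tE.
pose Ls := mask m (enum J).
pose L := [set i in Ls]%SET.
have Lu : uniq Ls by rewrite mask_uniq// enum_uniq.
have LJ : L \subset J.
  by apply/fintype.subsetP => i; rewrite inE => /mem_mask; rewrite mem_enum.
have LE : size S' = #|L| by rewrite (perm_size St) tE size_map /L cardsE (card_uniqP Lu).
have bigE (V : nmodType) (F : 'cV[R]_p -> V) :
    \sum_(x <- S') F x = \sum_(i in L) F (pt i).
  rewrite (perm_big _ St)/= tE big_map big_uniq//=.
  by apply: eq_bigl => i; rewrite inE.
rewrite LE in hS.
have L4 : n%:R <= 4 * #|L|%:R :> R.
  have J0 : 0 < #|J|%:R :> R by have := nR; have := Jbig; lra.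
  by have := ler_wpM2r (ltW J0) (ltW e2); have := Jbig; lra.
have L0 : 0 < #|L|%:R :> R by have := nR; lra.
have lin4 (c : R) : 0 <= c -> (#|L|%:R)^-1 * (c * n%:R) <= 4 * c.
  by move=> c0; rewrite ler_pdivrMl//; nra.
split.
  have -> : mean S' - mu = sigma *: ((#|L|%:R)^-1 *: \sum_(i in L) h i).
    rewrite /mean LE bigE (eq_bigr _ (fun i _ => ptE i)) big_split/= sumr_const.
    rewrite -scaler_sumr scalerDr -[mu *+ _]scaler_nat [_^-1 *: (_%:R *: _)]scalerA mulVf ?gt_eqF// scale1r.
    by rewrite addrC addKr scalerA mulrC -scalerA.
  apply: norm2_dual => v v1; rewrite !dotvZl dotv_suml ler_wpM2l//.
  apply: le_trans delta_lin.
  apply: le_trans (lin4 _ _); last first.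
    rewrite addr_ge0 ?sqrtr_ge0//.
    have := lin (v := 0); rewrite dotv0r ler01 => /(_ isT).
    by move=> /(le_trans (normr_ge0 _)); rewrite pmulr_lge0.
  by rewrite ler_wpM2l ?invr_ge0 ?ler0n//; exact: subset_lin.
have matE v : (second_moment S' mu - (sigma ^+ 2)%:M) *m v =
    sigma ^+ 2 *: (#|L|%:R^-1 *: (\sum_(i in L) dotv (h i) v *: h i) - v).
  rewrite /second_moment LE bigE mulmxBl mul_scalar_mx scalerBr; congr (_ - _).
  rewrite -scalemxAl mulmx_suml scalerA mulrC -scalerA; congr (_ *: _).
  rewrite scaler_sumr; apply: eq_bigr => i _.
  rewrite ptE addrAC subrr add0r [(_ *: _)^T]linearZ/= -scalemxAl -scalemxAr.
  rewrite -!scalemxAl scalerA -expr2; congr (_ *: _).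
  by rewrite -mulmxA [_^T *m _]mx11_scalar mul_mx_scalar.
apply: ge_sup.
  exists (norm2 ((second_moment S' mu - (sigma ^+ 2)%:M) *m (delta_mx (Ordinal p0) ord0 : 'cV[R]_p))).
  exists (delta_mx (Ordinal p0) ord0) => //=.
  rewrite /norm2 dotvE (bigD1 (Ordinal p0))//= big1 => [|i ine].
    by rewrite !mxE !eqxx/= mulr1 addr0 sqrtr1.
  by rewrite !mxE (negbTE ine)/= mulr0.
move=> _ [v /= nv <-].
have v1 : dotv v v <= 1 by rewrite -norm2_sqr nv expr1n.
rewrite matE; apply: norm2_dual => w w1.
rewrite dotvZl -[leRHS]mulrA ler_wpM2l ?sqr_ge0//.
rewrite dotvBl dotvZl dotv_suml.
apply: (@le_trans _ _ (4 * Lam + 1)); last by rewrite ler_pdivlMr.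
apply: lerD.
  apply: le_trans (lin4 _ Lam0); rewrite ler_wpM2l ?invr_ge0 ?ler0n//.
  apply: le_trans (subset_quad LJ v1 w1); apply: le_trans (ler_norm _).
  by rewrite le_eqVlt; apply/orP; left; apply/eqP; apply: eq_bigr => i _; rewrite dotvZl.
have := cauchy_schwarz v w; move: v1 w1 (dotv_ge0 v) (dotv_ge0 w).
by move: (dotv v v) (dotv w w) (dotv v w) => a b c *; nra.
Qed.

End stability.

(** * Products of independent random variables *)

(** The random variable [G] plays the role of a product of functions of the
    other independent variables.  Its independence from [U] is only assumed
    through integrals against indicators, and is extended to nonnegative
    functions of [U] by monotone convergence. *)
Section tensor.
Local Open Scope ereal_scope.
Context d (Omega : measurableType d) (R : realType) (P : probability Omega R).
Context d' (E : measurableType d') (U : Omega -> E).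
Hypothesis mU : measurable_fun setT U.

Import HBNNSimple.

Lemma integral_mul_nnsfun (G : Omega -> R) (h : {nnsfun E >-> R}) :
  measurable_fun setT G -> (forall w, 0 <= G w)%R ->
  \int[P]_w (G w * h (U w))%:E =
  \sum_(y \in range h) (y%:E * \int[P]_w (G w * \1_(h @^-1` [set y]) (U w))%:E).
Proof.
move=> mG G0.
have mind y : measurable_fun setT (fun w => \1_(h @^-1` [set y]) (U w) : R).
  by apply: measurableT_comp => //; exact: measurable_indic.
transitivity (\int[P]_w \sum_(y \in range h) (y * (G w * \1_(h @^-1` [set y]) (U w)))%:E).
  apply: eq_integral => w _; rewrite fsumEFin//; congr EFin.
  rewrite [in LHS]fimfunE !fsbig_finite//= mulr_sumr; apply: eq_bigr => y _.
  by rewrite mulrCA.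
rewrite ge0_integral_fsum//; last 2 first.
- by move=> y; apply/measurable_EFinP; apply: measurable_funM => //; exact: measurable_funM.
- move=> y w _; have [y0|y0] := leP 0%R y; first by rewrite lee_fin !mulr_ge0.
  by rewrite preimage_nnfun0// indic0 !mulr0.
apply: eq_fsbigr => y /[!inE] -[e _ <-].
under eq_integral do rewrite EFinM.
rewrite ge0_integralZl//.
- by apply/measurable_EFinP; exact: measurable_funM.
- by move=> w _; rewrite lee_fin mulr_ge0.
- by rewrite lee_fin.
Qed.

Lemma cvg_integral_mul (G : Omega -> R) (f : E -> R) (mf : measurable_fun setT (EFin \o f)) :
  measurable_fun setT G -> (forall w, 0 <= G w)%R -> (forall e, 0 <= f e)%R ->
  \int[P]_w (G w * nnsfun_approx measurableT mf n (U w))%:E @[n --> \oo]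
    --> \int[P]_w (G w * f (U w))%:E.
Proof.
move=> mG G0 f0.
have fE e : EFin \o (nnsfun_approx measurableT mf)^~ e @ \oo --> (f e)%:E.
  by apply: cvg_nnsfun_approx => // x _; rewrite /= lee_fin.
rewrite (_ : \int[P]_w (G w * f (U w))%:E = \int[P]_w
   (limn (fun n => (G w * nnsfun_approx measurableT mf n (U w))%:E))); last first.
  apply: eq_integral => w _; apply/esym/cvg_lim => //.
  rewrite EFinM; under eq_fun do rewrite EFinM.
  by apply: cvgeZl => //; exact: fE.
apply: cvg_monotone_convergence => //.
- move=> n; apply/measurable_EFinP; apply: measurable_funM => //.
  by apply: measurableT_comp => //; exact: measurable_funP.
- by move=> n w _; rewrite lee_fin mulr_ge0.
- move=> w _ m n mn; rewrite lee_fin ler_wpM2l//.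
  exact/lefP/nd_nnsfun_approx.
Qed.

Lemma integral_tensor (G : Omega -> R) (f : E -> R) :
  measurable_fun setT G -> (forall w, 0 <= G w)%R ->
  \int[P]_w (G w)%:E \is a fin_num ->
  (forall A, measurable A ->
    \int[P]_w (G w * \1_A (U w))%:E = \int[P]_w (G w)%:E * P [set w | A (U w)]) ->
  measurable_fun setT f -> (forall e, 0 <= f e)%R ->
  \int[P]_w (G w * f (U w))%:E = \int[P]_w (G w)%:E * \int[P]_w (f (U w))%:E.
Proof.
move=> mG G0 Gfin GA mf f0.
have mf' : measurable_fun setT (EFin \o f) by apply/measurable_EFinP.
have h1 := cvg_integral_mul mf' mG G0 f0.
have h2 := @cvg_integral_mul (cst 1%R) _ mf' (measurable_cst _) (fun=> ler01) f0.
have {}h2 := cvgeZl Gfin h2.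
have -> : \int[P]_w (f (U w))%:E = \int[P]_w (cst 1%R w * f (U w))%:E.
  by apply: eq_integral => w _; rewrite mul1r.
suff EA n : \int[P]_w (G w * nnsfun_approx measurableT mf' n (U w))%:E =
    \int[P]_w (G w)%:E * \int[P]_w (cst 1%R w * nnsfun_approx measurableT mf' n (U w))%:E.
  apply: (cvg_unique _ h1) => //.
  by move: h2; under [X in X @ _ --> _ -> _]eq_fun do rewrite -EA.
rewrite !integral_mul_nnsfun//.
rewrite !fsbig_finite//= ge0_sume_distrr; last first.
  move=> y _; have [y0|y0] := leP 0%R y.
    by rewrite mule_ge0 ?lee_fin// integral_ge0// => w _; rewrite lee_fin mulr_ge0.
  by rewrite preimage_nnfun0// integral0_eq ?mule0// => w _; rewrite indic0 mulr0.
apply: eq_bigr => y _.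
have mh : measurable (nnsfun_approx measurableT mf' n @^-1` [set y]) by exact: measurable_funPTI.
rewrite GA// muleCA; congr (_ * (_ * _)).
have mS : measurable [set w | (nnsfun_approx measurableT mf' n @^-1` [set y]) (U w)].
  by rewrite -[X in measurable X]setTI; exact: mU.
rewrite -(setIT [set w | _]) -integral_indic//.
by apply: eq_integral => w _; rewrite mul1r !indicE.
Qed.

End tensor.

Section independent_product.
Local Open Scope ereal_scope.
Context d (Omega : measurableType d) (R : realType) (P : probability Omega R).
Context d' (E : measurableType d') (n : nat) (X : 'I_n -> Omega -> E).
Hypothesis mX : forall i, measurable_fun setT (X i).
Hypothesis indX : mutually_independent P X.

Let mset_X i (A : set E) : measurable A -> measurable [set w | A (X i w)].
Proof. by move=> mA; rewrite -[X in measurable X]setTI; exact: mX. Qed.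

Lemma integral_indic_comp i (A : set E) : measurable A ->
  \int[P]_w (\1_A (X i w) : R)%:E = P [set w | A (X i w)].
Proof.
move=> mA; rewrite -[in RHS](setIT [set w | _]) -integral_indic//; exact: mset_X.
Qed.

(** Mutual independence is the case where all the functions are indicators;
    they are replaced by general functions one at a time. *)
Let independent_product_upto (k : nat) : (k <= n)%N -> forall f : 'I_n -> E -> R,
  (forall i, measurable_fun setT (f i)) -> (forall i e, 0 <= f i e)%R ->
  (forall i, \int[P]_w (f i (X i w))%:E \is a fin_num) ->
  (forall i : 'I_n, (k <= i)%N -> exists2 A, measurable A & f i = \1_A) ->
  \int[P]_w (\prod_i f i (X i w))%:E = \prod_i \int[P]_w (f i (X i w))%:E.
Proof.
elim: k => [_ f mf f0 ffin fI|k IH kn f mf f0 ffin fI].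
  have /choice[A hA] : forall i, exists A, measurable A /\ f i = \1_A.
    by move=> i; have [A mA fA] := fI i (leq0n _); exists A.
  have mA i : measurable (A i) by have [] := hA i.
  have fA i : f i = \1_(A i) by have [] := hA i.
  under [RHS]eq_bigr => i _ do rewrite fA integral_indic_comp//.
  have := @indX [set: 'I_n]%SET A mA.
  rewrite [X in _ = X -> _](eq_bigl xpredT) => [<-|i]; last by rewrite inE.
  have mS : measurable [set w | forall i, i \in [set: 'I_n]%SET -> A i (X i w)].
    rewrite (_ : [set w | _] = \bigcap_(i in [set: 'I_n]) [set w | A i (X i w)]).
      by apply: fin_bigcap_measurable => // i _; exact: mset_X.
    by apply/seteqP; split => w /= h i _; [apply: h; rewrite inE|exact: h].
  rewrite -[in RHS](setIT [set w | _]) -integral_indic//.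
  apply: eq_integral => w _; congr EFin.
  rewrite (eq_bigr _ (fun i _ => congr1 (@^~ (X i w)) (fA i))) indicE.
  have [h|h] := pselect (forall i, A i (X i w)).
    rewrite mem_set//= big1// => i _; rewrite indicE mem_set//.
  rewrite memNset/=; last by move=> h'; apply: h => i; apply: h'; rewrite inE.
  have /existsNP[i hi] := h.
  by rewrite (bigD1 i)//= indicE memNset// mul0r.
pose i0 := Ordinal kn.
pose G w := (\prod_(i | i != i0) f i (X i w))%R.
have mG : measurable_fun setT G.
  rewrite /G; under eq_fun do rewrite big_mkcond.
  apply: measurable_prod => i _; have [_|_] := eqVneq i i0; first exact: measurable_cst.
  by apply: (measurableT_comp (mf i)); exact: mX.
have G0 w : (0 <= G w)%R by apply: prodr_ge0.
have GA A : measurable A -> \int[P]_w (G w * \1_A (X i0 w))%:E =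
    P [set w | A (X i0 w)] * \prod_(i | i != i0) \int[P]_w (f i (X i w))%:E.
  move=> mA; pose f' i := if i == i0 then \1_A : E -> R else f i.
  have f'i i : i != i0 -> f' i = f i by rewrite /f' => /negbTE->.
  have f'0 : f' i0 = \1_A by rewrite /f' eqxx.
  have := IH (ltnW kn) f' _ _ _ _.
  rewrite (bigD1 i0)//= f'0 integral_indic_comp//.
  rewrite (eq_bigr (fun i => \int[P]_w (f i (X i w))%:E)) => [H|i ii0]; last first.
    by rewrite f'i.
  rewrite -H.
  - apply: eq_integral => w _; rewrite (bigD1 i0)//= f'0 mulrC; congr (_ * _)%:E.
    by apply: eq_bigr => i ii0; rewrite f'i.
  - move=> i; rewrite /f'; case: ifP => // _; exact: measurable_indic.
  - by move=> i e; rewrite /f'; case: ifP.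
  - move=> i; have [->|ii0] := eqVneq i i0; last by rewrite f'i.
    by rewrite f'0 integral_indic_comp// fin_num_measure//; exact: mset_X.
  - move=> i ki; have [->|ii0] := eqVneq i i0; first by exists A.
    rewrite f'i//; apply: fI; rewrite ltn_neqAle ki andbT eq_sym.
    by apply: contra ii0 => /eqP ik; apply/eqP/val_inj.
have GE : \int[P]_w (G w)%:E = \prod_(i | i != i0) \int[P]_w (f i (X i w))%:E.
  have := GA setT measurableT; rewrite probability_setT mul1e => <-.
  by apply: eq_integral => w _; rewrite indicT mulr1.
have Gfin : \int[P]_w (G w)%:E \is a fin_num.
  by rewrite GE; apply: prode_fin_num => i _; exact: ffin.
rewrite [RHS](bigD1 i0)//= -GE muleC -integral_tensor//.
  by apply: eq_integral => w _; rewrite (bigD1 i0)//= mulrC.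
by move=> A mA; rewrite GA// muleC GE.
Qed.

Lemma integral_independent_product (f : 'I_n -> E -> R) :
  (forall i, measurable_fun setT (f i)) -> (forall i e, 0 <= f i e)%R ->
  (forall i, \int[P]_w (f i (X i w))%:E \is a fin_num) ->
  \int[P]_w (\prod_i f i (X i w))%:E = \prod_i \int[P]_w (f i (X i w))%:E.
Proof.
move=> mf f0 ffin; apply: (independent_product_upto (leqnn n)) => // i.
by rewrite leqNgt ltn_ord.
Qed.

(** The bound on the exponential moment is passed through a majorant [psi] of
    exp phi - 1, which need not be bounded: for the truncated statistics used
    below, [psi] is a quadratic polynomial in the untruncated variable, and
    its mean is known exactly or bounded. *)
Lemma chernoff_independent (phi psi : 'I_n -> E -> R) (m t : R) :
  (forall i, measurable_fun setT (phi i)) ->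
  (forall i e, expR (phi i e) <= 1 + psi i e)%R ->
  (forall i, P.-integrable setT (fun w => (psi i (X i w))%:E)) ->
  (forall i, \int[P]_w (psi i (X i w))%:E <= m%:E) ->
  P [set w | t < \sum_i phi i (X i w)]%R <= (expR (n%:R * m - t))%:E.
Proof.
move=> mphi phipsi ipsi psim.
have mphiX i : measurable_fun setT (fun w => phi i (X i w)) by exact: measurableT_comp.
have mS : measurable_fun setT (fun w => \sum_i phi i (X i w))%R by exact: measurable_sum.
have mexp i : measurable_fun setT (expR \o phi i) by exact: measurableT_comp.
have le1m i : \int[P]_w (expR (phi i (X i w)))%:E <= (1 + m)%:E.
  apply: (@le_trans _ _ (\int[P]_w (1 + psi i (X i w))%:E)).
    apply: ge0_le_integral => //.
    - by apply/measurable_EFinP; exact: measurableT_comp.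
    - apply/measurable_EFinP; apply: measurable_funD => //.
      by have /integrableP[/measurable_EFinP] := ipsi i.
    - by move=> w _; rewrite lee_fin.
  rewrite (_ : (fun w => _) = (EFin \o cst 1%R) \+ (fun w => (psi i (X i w))%:E))//.
  rewrite integralD//; last by apply: finite_measure_integrable_cst.
  rewrite [X in X + _](_ : _ = 1); first by rewrite EFinD leeD2l.
  transitivity (\int[P]_w cst 1 w)=> //; rewrite integral_cst// mul1e. exact: probability_setT.
have ge0i i : 0 <= \int[P]_w (expR (phi i (X i w)))%:E.
  by apply: integral_ge0 => w _; rewrite lee_fin expR_ge0.
have fini i : \int[P]_w (expR (phi i (X i w)))%:E \is a fin_num.
  by rewrite ge0_fin_numE//; apply: le_lt_trans (le1m i) _; rewrite ltry.
have prodE : \int[P]_w (expR (\sum_i phi i (X i w)))%:E <= (expR (n%:R * m))%:E.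
  under eq_integral do rewrite expR_sum.
  rewrite (@integral_independent_product (fun i => expR \o phi i))//; last first.
    by move=> i e; rewrite /= expR_ge0.
  apply: (@le_trans _ _ (\prod_(i < n) (expR m)%:E)); last first.
    by rewrite prodEFin prodr_const card_ord -expRM_natl.
  rewrite -(eq_bigr _ (fun i _ => fineK (fini i))) !prodEFin lee_fin.
  apply: ler_prod => i _; rewrite fine_ge0//= -lee_fin fineK//.
  by apply: le_trans (le1m i) _; rewrite lee_fin expR_ge1Dx.
have mset : measurable [set w | t < \sum_i phi i (X i w)]%R.
  rewrite -[X in measurable X]setTI.
  by apply: (measurable_fun_ltr _ mS) => //.
rewrite expRD EFinM expRN lee_pdivlMr ?expR_gt0// muleC.
apply: le_trans prodE.
rewrite -(setIT [set w | _]) -integral_indic// -ge0_integralZl//; last first.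
  by apply/measurable_EFinP; exact: measurable_indic.
apply: ge0_le_integral => //.
- apply/measurable_EFinP; apply: measurable_funM => //; exact: measurable_indic.
- by apply/measurable_EFinP; exact: measurableT_comp.
move=> w _; rewrite -EFinM lee_fin indicE.
have [h|h] := pselect (t < \sum_i phi i (X i w))%R.
  by rewrite mem_set// mulr1 ler_expR ltW.
by rewrite memNset// mulr0 expR_ge0.
Qed.

End independent_product.

(** * Means of real random variables *)

(** Integrability and the value of the integral travel together, so that
    expectations can be computed by applying lemmas without side
    conditions. *)
Definition has_mean d (Omega : measurableType d) (R : realType)
    (P : probability Omega R) (f : Omega -> R) (r : R) :=
  P.-integrable setT (EFin \o f) /\ (\int[P]_w (f w)%:E = r%:E)%E.

Section has_mean.
Context d (Omega : measurableType d) (R : realType) (P : probability Omega R).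
Implicit Types f g : Omega -> R.

Lemma has_mean_ext f g r : f =1 g -> has_mean P f r -> has_mean P g r.
Proof. by move=> /funext ->. Qed.

Lemma has_mean_measurable f r : has_mean P f r -> measurable_fun setT f.
Proof. by move=> [/integrableP[/measurable_EFinP]]. Qed.

Lemma has_mean_cst r : has_mean P (cst r) r.
Proof.
split; first exact: finite_measure_integrable_cst.
transitivity (\int[P]_w (cst r%:E w))%E => //.
rewrite integral_cst// -[RHS]mule1; congr (_ * _)%E; exact: probability_setT.
Qed.

Lemma has_mean0 : has_mean P (cst 0) 0. Proof. exact: has_mean_cst. Qed.

Lemma has_meanD f g r s : has_mean P f r -> has_mean P g s ->
  has_mean P (fun w => f w + g w) (r + s).
Proof.
move=> [If Ef] [Ig Eg]; split; first exact: (integrableD measurableT If Ig).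
by rewrite (integralD_EFin measurableT If Ig) Ef Eg.
Qed.

Lemma has_meanZ f r a : has_mean P f r -> has_mean P (fun w => a * f w) (a * r).
Proof.
move=> [If Ef]; split; first exact: (integrableZl measurableT a If).
by have := integralZl measurableT If a; rewrite Ef.
Qed.

Lemma has_meanB f g r s : has_mean P f r -> has_mean P g s ->
  has_mean P (fun w => f w - g w) (r - s).
Proof.
move=> hf /(has_meanZ (-1)) hg; have := has_meanD hf hg.
by rewrite mulN1r; apply: has_mean_ext => w; rewrite mulN1r.
Qed.

Lemma has_mean_sum (I : Type) (s : seq I) (F : I -> Omega -> R) (r : I -> R) :
  (forall i, has_mean P (F i) (r i)) ->
  has_mean P (fun w => \sum_(i <- s) F i w) (\sum_(i <- s) r i).
Proof.
move=> h; elim: s => [|i s IH].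
  rewrite big_nil; apply: has_mean_ext has_mean0 => w; by rewrite big_nil.
rewrite big_cons; apply: has_mean_ext (has_meanD (h i) IH) => w.
by rewrite big_cons.
Qed.

Lemma has_mean_ge0 f r : measurable_fun setT f -> (forall w, 0 <= f w) ->
  (\int[P]_w (f w)%:E = r%:E)%E -> has_mean P f r.
Proof.
move=> mf f0 E; split => //; apply/integrableP; split; first exact/measurable_EFinP.
rewrite (_ : (\int[P]_w _)%E = r%:E) ?ltry// -E.
by apply: eq_integral => w _; rewrite /= ger0_norm.
Qed.

Lemma has_mean_dom f g r : measurable_fun setT f -> (forall w, `|f w| <= g w) ->
  has_mean P g r -> exists s, has_mean P f s.
Proof.
move=> mf fg [Ig _].
have If : P.-integrable setT (EFin \o f).
  apply: le_integrable Ig => //; first exact/measurable_EFinP.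
  move=> w _; rewrite lee_fin (ger0_norm (le_trans _ (fg w)))//.
exists (fine (\int[P]_w (f w)%:E)%E); split=> //.
by rewrite fineK//; exact: integrable_fin_num.
Qed.

Lemma has_mean_le f g r s : (forall w, f w <= g w) -> has_mean P f r ->
  has_mean P g s -> r <= s.
Proof.
move=> fg [If Ef] [Ig Eg]; rewrite -lee_fin -Ef -Eg.
by apply: le_integral => // w _; rewrite lee_fin.
Qed.

End has_mean.

Section independent_pair.
Context d (Omega : measurableType d) (R : realType) (P : probability Omega R).
Context d1 (E1 : measurableType d1) d2 (E2 : measurableType d2).
Context (U : Omega -> E1) (V : Omega -> E2).
Hypotheses (mU : measurable_fun setT U) (mV : measurable_fun setT V).
Hypothesis indUV : independent_of P U V.

Lemma has_meanM_ge0 (f : E1 -> R) (g : E2 -> R) (r s : R) :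
  measurable_fun setT f -> measurable_fun setT g ->
  (forall e, 0 <= f e) -> (forall e, 0 <= g e) ->
  has_mean P (f \o U) r -> has_mean P (g \o V) s ->
  has_mean P (fun w => f (U w) * g (V w)) (r * s).
Proof.
move=> mf mg f0 g0 [If Ef] [Ig Eg].
have mset1 (A : set E1) : measurable A -> measurable [set w | A (U w)].
  by move=> mA; rewrite -[X in measurable X]setTI; exact: mU.
have mset2 (A : set E2) : measurable A -> measurable [set w | A (V w)].
  by move=> mA; rewrite -[X in measurable X]setTI; exact: mV.
have mfU : measurable_fun setT (f \o U) by exact: measurableT_comp.
have mgV : measurable_fun setT (g \o V) by exact: measurableT_comp.
apply: has_mean_ge0.
- exact: measurable_funM.
- by move=> w; rewrite mulr_ge0.
rewrite EFinM -Ef -Eg.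
apply: (@integral_tensor _ _ _ _ _ _ _ mV (f \o U) g) => //.
- by move=> w; exact: f0.
- exact: (integrable_fin_num measurableT If).
move=> B mB.
have intB : (\int[P]_w (\1_B (V w) : R)%:E = P [set w | B (V w)])%E.
  by rewrite -[in RHS](setIT [set w | _]) -integral_indic//; exact: mset2.
rewrite [LHS](_ : _ = \int[P]_w ((\1_B (V w) : R) * f (U w))%:E)%E; last first.
  by apply: eq_integral => w _; rewrite mulrC.
rewrite (@integral_tensor _ _ _ _ _ _ _ mU (fun w => \1_B (V w)) f)//.
- by rewrite intB muleC.
- by apply: measurableT_comp => //; exact: measurable_indic.
- by rewrite intB fin_num_measure//; exact: mset2.
move=> A mA; rewrite intB muleC -indUV//.
rewrite -[in RHS](setIT [set w | _]) -integral_indic//; last first.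
  by apply: measurableI; [exact: mset1|exact: mset2].
apply: eq_integral => w _; congr EFin; rewrite !indicE.
have [hA|hA] := pselect (A (U w)); have [hB|hB] := pselect (B (V w)).
- by rewrite !mem_set ?mulr1.
- by rewrite (memNset hB) mul0r memNset//= => -[].
- by rewrite (memNset hA) mulr0 memNset//= => -[].
- by rewrite (memNset hA) mulr0 memNset//= => -[].
Qed.

(** Both factors are written as halves of differences of nonnegative functions,
    |f| + f and |f| - f; since [g] is centered, the two pieces of [g] have the
    same mean and the four products cancel. *)
Lemma has_meanM_centered (f : E1 -> R) (g : E2 -> R) (r : R) :
  measurable_fun setT f -> measurable_fun setT g ->
  has_mean P (f \o U) r -> has_mean P (g \o V) 0 ->
  has_mean P (fun w => f (U w) * g (V w)) 0.
Proof.
move=> mf mg hf hg.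
have mfU : measurable_fun setT (f \o U) by exact: measurableT_comp.
have mgV : measurable_fun setT (g \o V) by exact: measurableT_comp.
have abs (h : Omega -> R) s : has_mean P h s -> exists t, has_mean P (fun w => `|h w|) t.
  move=> [Ih _]; exists (fine (\int[P]_w `|h w|%:E)%E).
  have Ih' : P.-integrable setT (EFin \o (fun w => `|h w|)).
    exact: (integrable_abse Ih).
  by split => //; rewrite fineK//; exact: integrable_fin_num.
have [a ha] := abs _ _ hf; have [b hb] := abs _ _ hg.
pose pos T (h : T -> R) e := `|h e| + h e; pose neg T (h : T -> R) e := `|h e| - h e.
have pos0 T (h : T -> R) e : 0 <= pos T h e by have := ler_norm (- h e); rewrite /pos normrN; lra.
have neg0 T (h : T -> R) e : 0 <= neg T h e by have := ler_norm (h e); rewrite /neg; lra.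
have mpos d' (T : measurableType d') (h : T -> R) : measurable_fun setT h -> measurable_fun setT (pos T h).
  by move=> mh; apply: measurable_funD => //; exact: measurableT_comp.
have mneg d' (T : measurableType d') (h : T -> R) : measurable_fun setT h -> measurable_fun setT (neg T h).
  by move=> mh; apply: measurable_funB => //; exact: measurableT_comp.
have hpf := has_meanD ha hf; have hnf := has_meanB ha hf.
have hpg := has_meanD hb hg; have hng := has_meanB hb hg.
have h1 := has_meanM_ge0 (mpos _ _ _ mf) (mpos _ _ _ mg) (pos0 _ f) (pos0 _ g) hpf hpg.
have h2 := has_meanM_ge0 (mpos _ _ _ mf) (mneg _ _ _ mg) (pos0 _ f) (neg0 _ g) hpf hng.
have h3 := has_meanM_ge0 (mneg _ _ _ mf) (mpos _ _ _ mg) (neg0 _ f) (pos0 _ g) hnf hpg.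
have h4 := has_meanM_ge0 (mneg _ _ _ mf) (mneg _ _ _ mg) (neg0 _ f) (neg0 _ g) hnf hng.
have := has_meanZ (1 / 4) (has_meanD (has_meanB (has_meanB h1 h2) h3) h4).
rewrite (_ : 1 / 4 * _ = 0); last by rewrite addr0 subr0; ring.
by apply: has_mean_ext => w; rewrite /pos /neg; lra.
Qed.

End independent_pair.

(** * Moments of the covariates *)

Lemma measurable_dotv (R : realType) p (v : 'cV[R]_p) :
  measurable_fun setT (fun t : p.-tuple R => dotv (colv t) v).
Proof.
rewrite (_ : (fun t => _) = (fun t => \sum_j tnth t j * v j ord0)); last first.
  by apply/funext => t; rewrite dotvE; apply: eq_bigr => j _; rewrite mxE.
apply: measurable_sum => j; apply: measurable_funM => //; exact: measurable_tnth.
Qed.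

Section covariate_moments.
Context d (Omega : measurableType d) (R : realType) (P : probability Omega R).
Context (p : nat) (x : Omega -> p.-tuple R) (sigma4 C : R).
Hypothesis mx : measurable_fun setT x.
Hypotheses (hC : 0 < C) (s4C : sigma4 <= C).
Hypothesis iso : isotropic P (fun w => colv (x w)).
Hypothesis hyper : hypercontractive42 P (fun w => colv (x w)) sigma4.

Let dx v w := dotv (colv (x w)) v.

Lemma measurable_dx v : measurable_fun setT (dx v).
Proof. by apply: (measurableT_comp (measurable_dotv v)). Qed.

Let mcoord j : measurable_fun setT (fun w => tnth (x w) j).
Proof. by apply: (measurableT_comp (measurable_tnth j)). Qed.

Lemma has_mean_coord2 j k :
  has_mean P (fun w => tnth (x w) j * tnth (x w) k) (j == k)%:R.
Proof.
have E i l : (\int[P]_w (tnth (x w) i * tnth (x w) l)%:E = ((i == l)%:R)%:E)%E.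
  have [_ /(_ i l)] := iso; rewrite unlock mxE => <-.
  apply: eq_integral => w _; congr EFin.
  by rewrite !mxE big_ord1 !mxE.
have sq i : has_mean P (fun w => tnth (x w) i * tnth (x w) i) 1.
  apply: has_mean_ge0; first exact: measurable_funM.
    by move=> w; rewrite -expr2 sqr_ge0.
  by rewrite E eqxx.
have [w|s [Is Es]] := has_mean_dom (measurable_funM (mcoord j) (mcoord k)) _
    (has_meanD (sq j) (sq k)).
- rewrite /= ler_norml; have := sqr_ge0 (tnth (x w) j - tnth (x w) k).
  have := sqr_ge0 (tnth (x w) j + tnth (x w) k).
  have := sqr_ge0 (tnth (x w) j); have := sqr_ge0 (tnth (x w) k).
  by move=> *; apply/andP; split; nra.
- by split=> //; exact: E.
Qed.

Lemma has_mean_coord j : has_mean P (fun w => tnth (x w) j) 0.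
Proof.
have [w|s [Is Es]] := has_mean_dom (mcoord j) _
    (has_meanD (has_mean_cst P 1) (has_mean_coord2 j j)).
- rewrite /= ler_norml.
  by apply/andP; split; nra.
- split=> //; have := iso.1 j; rewrite unlock => E0; apply: etrans E0.
  by apply: eq_integral => w _; rewrite mxE.
Qed.

Lemma dxE v w : dx v w = \sum_j v j ord0 * tnth (x w) j.
Proof. by rewrite /dx dotvE; apply: eq_bigr => j _; rewrite mxE mulrC. Qed.

Lemma has_mean_dx v : has_mean P (dx v) 0.
Proof.
have := has_mean_sum (index_enum _) (fun j => has_meanZ (v j ord0) (has_mean_coord j)).
rewrite big1 => [|j _]; last by rewrite mulr0.
by apply: has_mean_ext => w; rewrite dxE.
Qed.

Lemma has_mean_dx2 u v : has_mean P (fun w => dx u w * dx v w) (dotv u v).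
Proof.
have := has_mean_sum (index_enum _) (fun j => has_mean_sum (index_enum _)
  (fun k => has_meanZ (u j ord0 * v k ord0) (has_mean_coord2 j k))).
rewrite [X in has_mean _ _ X](_ : _ = dotv u v).
  apply: has_mean_ext => w; rewrite !dxE mulr_suml; apply: eq_bigr => j _.
  by rewrite mulr_sumr; apply: eq_bigr => k _; ring.
rewrite dotvE; apply: eq_bigr => j _; rewrite (bigD1 j)//= eqxx mulr1 big1 ?addr0//.
by move=> k kj; rewrite eq_sym (negbTE kj) mulr0.
Qed.

(** For a unit vector the two norms of the hypercontractivity hypothesis are
    powers of the fourth moment and of 1; other vectors follow by scaling. *)
Lemma has_mean_dx4 v : dotv v v <= 1 ->
  exists2 r, r <= C ^+ 4 & has_mean P (fun w => dx v w ^+ 4) r.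
Proof.
have C4 : 0 <= C ^+ 4 by rewrite exprn_ge0// ltW.
have mdx4 u : measurable_fun setT (fun w => dx u w ^+ 4).
  by apply: measurable_funX; exact: measurable_dx.
have key u : norm2 u = 1 -> exists2 r, r <= C ^+ 4 & has_mean P (fun w => dx u w ^+ 4) r.
  move=> u1; have := hyper u1; rewrite unlock.
  have -> : (\int[P]_w `|(dotv u (colv (x w)))%:E| `^ 2 = 1)%E.
    have [_] := has_mean_dx2 u u; rewrite -norm2_sqr u1 expr1n => <-.
    apply: eq_integral => w _; rewrite /= powR_mulrn// real_normK ?num_real//.
    by rewrite /dx dotvC expr2.
  rewrite poweR1r mule1.
  have -> : (\int[P]_w `|(dotv u (colv (x w)))%:E| `^ 4 = \int[P]_w (dx u w ^+ 4)%:E)%E.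
    apply: eq_integral => w _; rewrite /= powR_mulrn// -normrX ger0_norm.
      by rewrite /dx dotvC.
    exact: exprn_even_ge0.
  set I := (\int[P]_w _)%E => hI.
  have dx40 w : 0 <= dx u w ^+ 4 by exact: exprn_even_ge0.
  have I0 : (0 <= I)%E by apply: integral_ge0 => w _; rewrite lee_fin.
  have IC : (I <= (C ^+ 4)%:E)%E.
    have -> : I = ((I `^ 4^-1) `^ 4)%E by rewrite -poweRrM mulVf// poweRe1.
    have -> : (C ^+ 4)%:E = (C%:E `^ 4)%E by rewrite /= powR_mulrn// ltW.
    apply: gt0_ler_poweR => //.
    - by rewrite in_itv/= leey poweR_ge0.
    - by rewrite in_itv/= leey lee_fin ltW.
    - by apply: le_trans hI _; rewrite lee_fin.
  have Ifin : I \is a fin_num by rewrite ge0_fin_numE// (le_lt_trans IC)// ltry.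
  exists (fine I); first by rewrite -lee_fin fineK.
  by apply: has_mean_ge0 => //; rewrite fineK.
move=> v1; have [v0|v0] := eqVneq (dotv v v) 0.
  exists 0 => //; apply: has_mean_ext (has_mean0 P) => w.
  by rewrite /dx (dotv_eq0 v0) dotv0r expr0n.
have np : 0 < norm2 v by rewrite sqrtr_gt0 lt_def v0 dotv_ge0.
have [|r rC hr] := key ((norm2 v)^-1 *: v).
  by rewrite {1}/norm2 dotvZl dotvZr mulrA -expr2 exprVn norm2_sqr mulVf// sqrtr1.
exists (norm2 v ^+ 4 * r).
  have r0 : 0 <= r.
    apply: has_mean_le (has_mean0 P) hr => w.
    exact: exprn_even_ge0.
  apply: le_trans rC; rewrite ler_piMl// exprn_ile1 ?norm2_ge0//.
  by rewrite -(@expr_le1 _ 2)// ?norm2_ge0// norm2_sqr.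
apply: has_mean_ext (has_meanZ _ hr) => w.
by rewrite /dx dotvZr exprMn exprVn mulrA mulfV ?mul1r// expf_neq0// gt_eqF.
Qed.

Lemma has_mean_norm2 :
  has_mean P (fun w => dotv (colv (x w)) (colv (x w))) p%:R.
Proof.
have := has_mean_sum (index_enum _) (fun j => has_mean_coord2 j j).
rewrite (eq_bigr (fun=> 1)) => [|j _]; last by rewrite eqxx.
rewrite sumr_const card_ord; apply: has_mean_ext => w.
by rewrite dotvE; apply: eq_bigr => j _; rewrite !mxE.
Qed.

End covariate_moments.

(** * Moments of the scores *)

Section score.
Context (R : realType) (p : nat) (betastar : 'cV[R]_p) (sigma K1 : R).

(** For sigma = 0 the quotient is 0, so that the noise of a datum is almost
    surely sigma times this value in all cases. *)
Definition noise (e : p.-tuple R * R) : R :=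
  (e.2 - dotv (colv e.1) betastar) / sigma.

(** The inner product with [v] of the gradient point of the datum [e], recentered
    at betastar and divided by sigma, for an estimator b such that
    betastar - b = sigma K1 a. *)
Definition score (a v : 'cV[R]_p) (e : p.-tuple R * R) : R :=
  (K1 * dotv (colv e.1) a + noise e) * dotv (colv e.1) v - K1 * dotv a v.

Let mdot v : measurable_fun setT (fun e : p.-tuple R * R => dotv (colv e.1) v).
Proof.
by apply: (measurableT_comp (measurable_dotv v)); exact: measurable_fst.
Qed.

Lemma measurable_noise : measurable_fun setT noise.
Proof.
apply: measurable_funM => //; apply: measurable_funB => //; exact: measurable_snd.
Qed.

Lemma measurable_score a v : measurable_fun setT (score a v).
Proof.
apply: measurable_funB => //; apply: measurable_funM => //.
by apply: measurable_funD; [exact: measurable_funM|exact: measurable_noise].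
Qed.

End score.

Section score_moments.
Context d (Omega : measurableType d) (R : realType) (P : probability Omega R).
Context (p : nat) (x : Omega -> p.-tuple R) (z : Omega -> R).
Context (betastar : 'cV[R]_p) (sigma4 C sigma K1 : R).
Hypotheses (mx : measurable_fun setT x) (mz : measurable_fun setT z).
Hypotheses (hC : 0 < C) (s4C : sigma4 <= C).
Hypothesis iso : isotropic P (fun w => colv (x w)).
Hypothesis hyper : hypercontractive42 P (fun w => colv (x w)) sigma4.
Hypothesis Ez : ('E_P[z] = 0)%E.
Hypothesis Ez2 : ('E_P[(fun w => z w ^+ 2)%R] = (sigma ^+ 2)%:E)%E.
Hypothesis indxz : independent_of P x z.

Let X w : p.-tuple R * R := (x w, dotv (colv (x w)) betastar + z w).

Lemma noiseE w : noise betastar sigma (X w) = z w / sigma.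
Proof. by rewrite /noise /= addrAC subrr add0r. Qed.

Lemma has_mean_z2 : has_mean P (fun w => z w ^+ 2) (sigma ^+ 2).
Proof.
apply: has_mean_ge0 => [|w|]; [exact: measurable_funX|exact: sqr_ge0|].
by rewrite -Ez2 unlock.
Qed.

Lemma has_mean_z : has_mean P z 0.
Proof.
have [w|s [Is _]] := has_mean_dom mz _ (has_meanD (has_mean_cst P 1) has_mean_z2).
  rewrite /= ler_norml.
  by apply/andP; split; nra.
by split => //; apply: etrans Ez; rewrite unlock.
Qed.

Lemma has_mean_noise2 : exists2 s, s <= 1 &
  has_mean P (fun w => (z w / sigma) ^+ 2) s.
Proof.
(* Equal to 1, or to 0 if sigma = 0. *)
exists (sigma ^- 2 * sigma ^+ 2).
  have [->|s0] := eqVneq sigma 0; first by rewrite expr0n mulr0 ler01.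
  by rewrite mulVf// expf_neq0.
by apply: has_mean_ext (has_meanZ _ has_mean_z2) => w; rewrite exprMn exprVn mulrC.
Qed.

Let dx v w := dotv (colv (x w)) v.

Lemma has_mean_noise_dx v : has_mean P (fun w => z w / sigma * dx v w) 0.
Proof.
have hn : has_mean P ((fun y => y / sigma) \o z) 0.
  have := has_meanZ (sigma^-1) has_mean_z; rewrite mulr0.
  by apply: has_mean_ext => w; rewrite /= mulrC.
have mg : measurable_fun setT (fun y : R => y / sigma) by exact: measurable_funM.
have := has_meanM_centered mx mz indxz (measurable_dotv v) mg
   (has_mean_dx mx iso v) hn.
by apply: has_mean_ext => w; rewrite mulrC.
Qed.

Lemma has_mean_noise2_dx2 v : dotv v v <= 1 -> exists2 s, s <= 1 &
  has_mean P (fun w => (z w / sigma) ^+ 2 * dx v w ^+ 2) s.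
Proof.
move=> v1; have [s s1 hs] := has_mean_noise2.
have mf : measurable_fun setT (fun t : p.-tuple R => dotv (colv t) v ^+ 2).
  by apply: measurable_funX; exact: measurable_dotv.
have mg : measurable_fun setT (fun y : R => (y / sigma) ^+ 2).
  by apply: measurable_funX; exact: measurable_funM.
have hv : has_mean P ((fun t => dotv (colv t) v ^+ 2) \o x) (dotv v v).
  by apply: has_mean_ext (has_mean_dx2 mx iso v v) => w; rewrite /= expr2.
exists (dotv v v * s).
  have s0 : 0 <= s by apply: has_mean_le (has_mean0 P) hs => w; exact: sqr_ge0.
  by have := dotv_ge0 v; nra.
have := has_meanM_ge0 mx mz indxz mf mg _ _ hv hs.
move=> /(_ (fun=> sqr_ge0 _) (fun=> sqr_ge0 _)).
by apply: has_mean_ext => w; rewrite mulrC.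
Qed.

Lemma has_mean_score a v : has_mean P (score betastar sigma K1 a v \o X) 0.
Proof.
have := has_meanB (has_meanD (has_meanZ K1 (has_mean_dx2 mx iso a v))
   (has_mean_noise_dx v)) (has_mean_cst P (K1 * dotv a v)).
rewrite addr0 subrr; apply: has_mean_ext => w.
by rewrite /= /score noiseE /= -/(dx _ _) mulrDl mulrA.
Qed.

Definition score_var : R := 3 * (K1 ^+ 2 * C ^+ 4 + K1 ^+ 2 + 1).

Lemma has_mean_score2 a v : dotv a a <= 1 -> dotv v v <= 1 ->
  exists2 s, s <= score_var & has_mean P (fun w => score betastar sigma K1 a v (X w) ^+ 2) s.
Proof.
move=> a1 v1.
have [ra raC ha] := has_mean_dx4 mx hC s4C iso hyper a1.
have [rv rvC hv] := has_mean_dx4 mx hC s4C iso hyper v1.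
have [s s1 hs] := has_mean_noise2_dx2 v1.
have av : dotv a v ^+ 2 <= 1.
  by apply: le_trans (cauchy_schwarz _ _) _; rewrite mulr_ile1 ?dotv_ge0.
have hdom := has_meanD (has_meanD (has_meanZ (3 / 2 * K1 ^+ 2) (has_meanD ha hv))
  (has_meanZ 3 hs)) (has_mean_cst P (3 * K1 ^+ 2)).
(* By (b + c - e)^2 <= 3 (b^2 + c^2 + e^2) and 2 A^2 V^2 <= A^4 + V^4. *)
have le w : score betastar sigma K1 a v (X w) ^+ 2 <=
   3 / 2 * K1 ^+ 2 * (dx a w ^+ 4 + dx v w ^+ 4) +
   3 * ((z w / sigma) ^+ 2 * dx v w ^+ 2) + 3 * K1 ^+ 2.
  rewrite /score noiseE /= -/(dx a w) -/(dx v w).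
  move: (dx a w) (dx v w) (z w / sigma) (dotv a v) av => A V n D hD.
  have h3 (b c e : R) : (b + c - e) ^+ 2 <= 3 * (b ^+ 2 + c ^+ 2 + e ^+ 2).
    have := sqr_ge0 (b - c); have := sqr_ge0 (b + e); have := sqr_ge0 (c + e).
    by nra.
  rewrite mulrDl; apply: le_trans (h3 _ _ _) _.
  have hAV : (K1 * A * V) ^+ 2 <= K1 ^+ 2 / 2 * (A ^+ 4 + V ^+ 4).
    have -> : (K1 * A * V) ^+ 2 = K1 ^+ 2 / 2 * (2 * (A ^+ 2 * V ^+ 2)) by field.
    rewrite ler_wpM2l ?divr_ge0 ?sqr_ge0//.
    have := sqr_ge0 (A ^+ 2 - V ^+ 2).
    have -> : (A ^+ 2 - V ^+ 2) ^+ 2 = A ^+ 4 + V ^+ 4 - 2 * (A ^+ 2 * V ^+ 2) by ring.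
    lra.
  have hKD : (K1 * D) ^+ 2 <= K1 ^+ 2 by rewrite exprMn ler_piMr// sqr_ge0.
  by have := exprMn 2 n V; lra.
have msc : measurable_fun setT (fun w => score betastar sigma K1 a v (X w) ^+ 2).
  by apply: measurable_funX; exact: (has_mean_measurable (has_mean_score a v)).
have [w|r hr] := has_mean_dom msc _ hdom.
  by rewrite /= ger0_norm ?sqr_ge0//; exact: le.
exists r => //; have := has_mean_le le hr hdom.
have := ler_wpM2l (sqr_ge0 K1) raC; have := ler_wpM2l (sqr_ge0 K1) rvC.
by rewrite /score_var; lra.
Qed.

End score_moments.

(** * Concentration on the grid *)

(** From exp x <= 1 / (1 - x), since
    (1 + x + 2 x^2) (1 - x) = 1 + x^2 (1 - 2 x). *)
Lemma expR_le_quad (R : realType) (x : R) : x <= 1 / 2 ->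
  expR x <= 1 + x + 2 * x ^+ 2.
Proof.
move=> x1; have h : expR x * (1 - x) <= 1.
  have := expR_ge1Dx (- x); rewrite expRN => h.
  rewrite -(@ler_pM2r _ (expR x)^-1) ?invr_gt0 ?expR_gt0//.
  by rewrite mulrAC mulfV ?gt_eqF ?expR_gt0// !mul1r.
have x0 : 0 < 1 - x by lra.
rewrite -(ler_pM2r x0); apply: le_trans h _.
have : 0 <= x ^+ 2 * (1 - 2 * x) by rewrite mulr_ge0 ?sqr_ge0//; lra.
have -> : x ^+ 2 * (1 - 2 * x) = (1 + x + 2 * x ^+ 2) * (1 - x) - 1 by ring.
by rewrite subr_ge0.
Qed.

(** The linear term on the right is not clipped: it integrates to 0 when [y] is
    centered.  It dominates because clip y <= y + y^2. *)
Lemma expR_half_clip (R : realType) (y : R) :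
  expR (clip y / 2) <= 1 + (y / 2 + y ^+ 2).
Proof.
have hy := sqr_ge0 (y + 1 / 2).
have h := @expR_le_quad R (clip y / 2).
case: (clipP y) => -[hc E]; rewrite E in h *;
  (apply: le_trans (h _) _; first lra); nra.
Qed.

Lemma expR_half_min (R : realType) (q : R) : 0 <= q ->
  expR (Num.min q 1 / 2) <= 1 + q.
Proof.
move=> q0; apply: (@le_trans _ _ (1 + Num.min q 1)); last by rewrite lerD2l ge_min lexx.
by apply: expR_half_le; [rewrite le_min q0 ler01|rewrite ge_min lexx orbT].
Qed.

Lemma clipN (R : realType) (y : R) : clip (- y) = - clip y.
Proof.
by case: (clipP y) => -[h ->]; case: (clipP (- y)) => -[h' ->]; lra.
Qed.

Lemma measurable_clip (R : realType) : measurable_fun setT (@clip R).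
Proof. by apply: measurable_maxr => //; exact: measurable_minr. Qed.

Lemma union_bound d (Omega : measurableType d) (R : realType)
    (P : probability Omega R) (I : finType) (F : I -> set Omega) (c : R) :
  (forall i, measurable (F i)) -> (forall i, P (F i) <= c%:E)%E ->
  measurable [set w | exists i, F i w] /\
  (P [set w | exists i, F i w] <= (#|I|%:R * c)%:E)%E.
Proof.
move=> mF Fc.
have -> : [set w | exists i, F i w] = \big[setU/set0]_(i <- enum I) F i.
  apply/seteqP; split => w /=.
    by move=> [i Fi]; rewrite (big_rem i) ?mem_enum//=; left.
  elim/big_rec : _ => // i A _ IH [|/IH //]; by exists i.
split; first by apply: bigsetU_measurable => i _.
rewrite cardE; elim: (enum I) => [|i s IH].
  by rewrite big_nil measure0 mul0r.
rewrite big_cons; apply: le_trans (measureU2 _ _ _) _ => //.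
  by apply: bigsetU_measurable => j _.
by rewrite /= -natr1 mulrDl mul1r EFinD addeC leeD.
Qed.

Section good_event.
Context d (Omega : measurableType d) (R : realType) (P : probability Omega R).
Context (p n : nat) (betastar : 'cV[R]_p).
Context (x : 'I_n -> {RV P >-> p.-tuple R}) (z : 'I_n -> {RV P >-> R}).
Context (sigma4 C sigma K1 kappa : R) (N : nat).
Hypotheses (p0 : (0 < p)%N) (hC : 0 < C) (s4C : sigma4 <= C).
Hypothesis model : linear_model betastar x z sigma4 sigma.
Hypothesis kappa0 : 0 < kappa.

Notation M := (score_var C K1).
Notation K := {ffun 'I_p -> bool * 'I_N.+1}.
Notation sc := (score betastar sigma K1).
Notation ns := (noise betastar sigma).

Definition datum i w : p.-tuple R * R := (x i w, response betastar x z i w).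

Definition data_norm2 (e : p.-tuple R * R) : R :=
  dotv (colv e.1) (colv e.1) + ns e ^+ 2.

Lemma measurable_datum i : measurable_fun setT (datum i).
Proof.
apply/measurable_fun_pairP; split => /=; first exact: measurable_funP.
apply: measurable_funD => //; apply: (measurableT_comp (measurable_dotv _)).
exact: measurable_funP.
Qed.

Lemma independent_coordinate i : independent_of P (x i) (z i).
Proof.
have [_ _ ind _ _] := model => A B mA mB.
have mt d' (T : measurableType d') (S : set T) : measurable S ->
    measurable [set t : n.-tuple T | S (tnth t i)].
  by move=> mS; rewrite -[X in measurable X]setTI; exact: measurable_tnth.
have := ind _ _ (mt _ _ _ mA) (mt _ _ _ mB).
rewrite (_ : [set w | _ /\ _] = [set w | A (x i w) /\ B (z i w)]).
  move=> ->; congr (P _ * P _)%E; apply/seteqP; split => w /=; by rewrite tnth_mktuple.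
by apply/seteqP; split => w /=; rewrite !tnth_mktuple.
Qed.

(** A single index type for all the statistics that have to concentrate, so
    that one tail bound and one union bound serve them all; the boolean is the
    sign of a one-sided deviation. *)
Let stat (u : option (K * K * option bool)) (e : p.-tuple R * R) : R :=
  match u with
  | None => Num.min (kappa / (2 * p%:R) * data_norm2 e) 1
  | Some (k, l, None) => Num.min ((Num.sqrt kappa * sc (ball_grid R k) (ball_grid R l) e) ^+ 2) 1
  | Some (k, l, Some b) =>
      clip ((-1) ^+ b * (Num.sqrt kappa * sc (ball_grid R k) (ball_grid R l) e))
  end.

Let bound (u : option (K * K * option bool)) (e : p.-tuple R * R) : R :=
  match u with
  | None => kappa / (2 * p%:R) * data_norm2 e
  | Some (k, l, None) => (Num.sqrt kappa * sc (ball_grid R k) (ball_grid R l) e) ^+ 2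
  | Some (k, l, Some b) =>
      (-1) ^+ b * (Num.sqrt kappa * sc (ball_grid R k) (ball_grid R l) e) / 2
      + (Num.sqrt kappa * sc (ball_grid R k) (ball_grid R l) e) ^+ 2
  end.

Lemma measurable_data_norm2 : measurable_fun setT data_norm2.
Proof.
apply: measurable_funD; last by apply: measurable_funX; exact: measurable_noise.
rewrite (_ : (fun e => _) = (fun e : p.-tuple R * R => \sum_j tnth e.1 j ^+ 2)); last first.
  by apply/funext => e; rewrite dotvE; apply: eq_bigr => j _; rewrite mxE expr2.
apply: measurable_sum => j; apply: measurable_funX.
apply: (measurableT_comp (measurable_tnth j)); exact: measurable_fst.
Qed.

Lemma data_norm2_ge0 e : 0 <= data_norm2 e.
Proof. by rewrite addr_ge0 ?dotv_ge0 ?sqr_ge0. Qed.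

Let measurable_stat u : measurable_fun setT (stat u).
Proof.
case: u => [[[k l] [b|]]|] /=.
- apply: (measurableT_comp (@measurable_clip R)); apply: measurable_funM => //.
  by apply: measurable_funM => //; exact: measurable_score.
- apply: measurable_minr => //; apply: measurable_funX; apply: measurable_funM => //.
  exact: measurable_score.
- by apply: measurable_minr => //; apply: measurable_funM => //; exact: measurable_data_norm2.
Qed.

Let pR : 0 < p%:R :> R. Proof. by rewrite ltr0n. Qed.

Let stat_bound u e : expR (stat u e / 2) <= 1 + bound u e.
Proof.
case: u => [[[k l] [b|]]|] /=.
- apply: le_trans (expR_half_clip _) _; by rewrite [((-1) ^+ b * _) ^+ 2]exprMn sqrr_sign mul1r.
- by apply: expR_half_min; rewrite sqr_ge0.
- by apply: expR_half_min; rewrite mulr_ge0 ?data_norm2_ge0// divr_ge0 ?mulr_ge0// ltW.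
Qed.

Lemma score_var_ge1 : 1 <= M.
Proof.
rewrite /score_var; have := sqr_ge0 K1.
have : 0 <= C ^+ 4 by rewrite exprn_ge0// ltW.
by nra.
Qed.

Let mean_bound u i : exists2 r, r <= M * kappa & has_mean P (bound u \o datum i) r.
Proof.
have [_ _ _ /(_ i)[iso hyp] /(_ i)[Ez Ez2]] := model.
have ind := independent_coordinate i.
have mx : measurable_fun setT (x i) by exact: measurable_funP.
have mz : measurable_fun setT (z i) by exact: measurable_funP.
have h1 (k l : K) := has_mean_score betastar K1 mx mz iso Ez Ez2 ind (ball_grid R k) (ball_grid R l).
have h2 k l := has_mean_score2 betastar K1 mx mz hC s4C iso hyp Ez Ez2 ind
    (@ball_grid_le1 R p N k) (@ball_grid_le1 R p N l).
have sk2 : Num.sqrt kappa ^+ 2 = kappa by rewrite sqr_sqrtr// ltW.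
case: u => [[[k l] [b|]]|] /=.
- have [s sM hs] := h2 k l.
  exists ((-1) ^+ b * Num.sqrt kappa / 2 * 0 + kappa * s); first by nra.
  have H := has_meanD (has_meanZ ((-1) ^+ b * Num.sqrt kappa / 2) (h1 k l)) (has_meanZ kappa hs).
  apply: has_mean_ext H => w.
  by rewrite /= exprMn sk2 -mulrA; ring.
- have [s sM hs] := h2 k l; exists (kappa * s); first by nra.
  have H := has_meanZ kappa hs.
  by apply: has_mean_ext H => w; rewrite /= exprMn sk2.
- have [s s1 hs] := has_mean_noise2 mz Ez2.
  exists (kappa / (2 * p%:R) * (p%:R + s)).
    have p1 : 1 <= p%:R :> R by rewrite ler1n.
    rewrite mulrAC ler_pdivrMr ?mulr_gt0//.
    apply: (@le_trans _ _ (kappa * (2 * p%:R))); first by rewrite ler_pM2l//; lra.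
    by rewrite -[leLHS]mul1r -[leRHS]mulrA ler_wpM2r ?score_var_ge1// mulr_ge0 ?mulr_ge0// ltW.
  have H := has_meanZ (kappa / (2 * p%:R)) (has_meanD (has_mean_norm2 mx iso) hs).
  apply: has_mean_ext H => w.
  by rewrite /= /data_norm2 (noiseE (x i) (z i)).
Qed.

Let tail u :
  let S := [set w | 4 * (M * kappa) * n%:R < \sum_i stat u (datum i w)] in
  measurable S /\ (P S <= (expR (- (M * kappa * n%:R)))%:E)%E.
Proof.
have mS : measurable_fun setT (fun w => \sum_i stat u (datum i w)).
  apply: measurable_sum => i; apply: (measurableT_comp (measurable_stat u)).
  exact: measurable_datum.
split; first by rewrite -[X in measurable X]setTI; apply: (measurable_fun_ltr _ mS).
rewrite (_ : [set w | _] = [set w | 2 * (M * kappa) * n%:R < \sum_i (stat u (datum i w) / 2)]); last first.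
  apply/seteqP; split => w /=; rewrite -mulr_suml; lra.
have -> : - (M * kappa * n%:R) = n%:R * (M * kappa) - 2 * (M * kappa) * n%:R by ring.
have [[indX _] _ _ _ _] := model.
apply: (chernoff_independent measurable_datum indX (phi := fun i e => stat u e / 2) (psi := fun=> bound u)).
- by move=> i; apply: measurable_funM.
- by move=> i e; exact: stat_bound.
- by move=> i; have [r _ []] := mean_bound u i.
- by move=> i; have [r rM [_ Er]] := mean_bound u i; rewrite [leLHS]Er lee_fin.
Qed.

(** Nontrivial only for sigma = 0, where the noise has second moment 0. *)
Lemma noise_rescaled_ae :
  let S := [set w | exists i, z i w != sigma * ns (datum i w)] in
  measurable S /\ P S = 0%E.
Proof.
have mz i : measurable_fun setT (z i) by exact: measurable_funP.
have nsE i w : ns (datum i w) = z i w / sigma by exact: (noiseE (x i) (z i)).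
have hi i : measurable [set w | z i w != sigma * ns (datum i w)] /\
    P [set w | z i w != sigma * ns (datum i w)] = 0%E.
  have [s0|s0] := eqVneq sigma 0; last first.
    rewrite (_ : [set w | _] = set0); first by split.
    rewrite -subset0 => w /=; rewrite nsE mulrCA divff// mulr1.
    by rewrite eqxx.
  have -> : [set w | z i w != sigma * ns (datum i w)] = [set w | ((z i w)%:E != 0)%E].
    by apply/seteqP; split => w /=; rewrite s0 mul0r.
  have mS : measurable [set w | ((z i w)%:E != 0)%E].
    rewrite -[X in measurable X]setTI; apply: emeasurable_neq => //.
    exact/measurable_EFinP.
  split => //.
  have [_ _ _ _ /(_ i)[_ Ez2]] := model.
  have : (\int[P]_w `|(z i w ^+ 2)%:E| = 0)%E.
    transitivity (\int[P]_w (z i w ^+ 2)%:E)%E.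
      by apply: eq_integral => w _; rewrite gee0_abs// lee_fin sqr_ge0.
    by move: Ez2; rewrite unlock s0 expr0n.
  move=> /(ae_eq_integral_abs P measurableT).
  have /measurable_EFinP : measurable_fun setT (fun w => z i w ^+ 2) by exact: measurable_funX.
  move=> + H => /H [B [mB PB sB]].
  apply/eqP; rewrite -measure_le0 -[leRHS]PB le_measure ?inE// => w /= zw.
  apply: sB => /= /(_ I) /eqP; rewrite eqe sqrf_eq0 => /eqP z0.
  by move: zw; rewrite z0 eqxx.
have [mS PS] := union_bound (fun i => (hi i).1) (fun i => eq_ind_r (fun t => t <= 0%:E)%E (lexx _) (hi i).2).
split=> //; apply/eqP; rewrite -measure_le0.
by move: PS; rewrite mulr0.
Qed.

Lemma good_event : exists G : set Omega,
  [/\ measurable G,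
      (P (~` G) <= ((1 + 3 * #|{: K}|%:R ^+ 2) * expR (- (M * kappa * n%:R)))%:E)%E &
      forall w, G w -> [/\ forall i, z i w = sigma * ns (datum i w),
        \sum_i Num.min (kappa / (2 * p%:R) * data_norm2 (datum i w)) 1
          <= 4 * (M * kappa) * n%:R &
        forall k l : K,
          \sum_i Num.min ((Num.sqrt kappa *
             sc (ball_grid R k) (ball_grid R l) (datum i w)) ^+ 2) 1
             <= 4 * (M * kappa) * n%:R /\
          `|\sum_i clip (Num.sqrt kappa *
             sc (ball_grid R k) (ball_grid R l) (datum i w))|
             <= 4 * (M * kappa) * n%:R]].
Proof.
have [mA PA] := union_bound (fun u => (tail u).1) (fun u => (tail u).2).
have [mB PB] := noise_rescaled_ae.
set A := [set w | exists i, _] in mA PA; set B := [set w | exists i, _] in mB PB.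
exists (~` (A `|` B)); split.
- by apply: measurableC; exact: measurableU.
- rewrite setCK; apply: le_trans (measureU2 _ _ _) _ => //.
  rewrite [X in (_ + X <= _)%E](_ : _ = 0%E); last exact: PB.
  rewrite adde0; apply: le_trans PA _; rewrite lee_fin ler_wpM2r ?expR_ge0//.
  rewrite card_option !card_prod card_option card_bool.
  by rewrite -natr1 !natrM expr2 addrC mulrC.
move=> w; rewrite setCU => -[nA nB]; split.
- move=> i; apply/eqP; apply/negP => h; apply: nB; exists i; exact/negP.
- by rewrite leNgt; apply/negP => h; apply: nA; exists None.
- move=> k l; split.
    by rewrite leNgt; apply/negP => h; apply: nA; exists (Some (k, l, None)).
  rewrite ler_norml; apply/andP; split; rewrite leNgt; apply/negP => h; apply: nA.
    exists (Some (k, l, Some true)); rewrite /stat /= expr1.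
    rewrite (eq_bigr _ (fun i _ => congr1 (@clip R) (mulN1r _))).
    by rewrite (eq_bigr _ (fun i _ => clipN _)) sumrN ltrNr.
  exists (Some (k, l, Some false)); rewrite /stat /= expr0.
  by rewrite (eq_bigr _ (fun i _ => congr1 (@clip R) (mul1r _))).
Qed.

End good_event.

(** * From the grid to all directions *)

Lemma abs_dotv_le (R : realType) p (u v : 'cV[R]_p) :
  `|dotv u v| <= norm2 u * norm2 v.
Proof.
rewrite -ler_sqr ?nnegrE ?mulr_ge0 ?norm2_ge0//.
by rewrite real_normK ?num_real// exprMn !norm2_sqr cauchy_schwarz.
Qed.

(** Scores vary slowly with the directions for data of moderate size, and the
    few data of large size are harmless in truncated sums. *)
Section transfer.
Context (R : realType) (p n : nat) (betastar : 'cV[R]_p) (sigma K1 kappa M : R).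
Context (N : nat) (e : 'I_n -> p.-tuple R * R).
Hypotheses (p0 : (0 < p)%N) (N0 : (0 < N)%N) (K10 : 0 < K1).
Hypotheses (kappa0 : 0 < kappa) (kappa1 : kappa <= 1) (M1 : 1 <= M).
Notation K := {ffun 'I_p -> bool * 'I_N.+1}.
Notation sc := (score betastar sigma K1).
Notation ns := (noise betastar sigma).
Notation s4 := (4 * (M * kappa) * n%:R).
Hypothesis fine_grid :
  (4 * K1 + 1) * (Num.sqrt p%:R / N%:R) * (2 * p%:R / kappa) <= Num.sqrt kappa.
Hypothesis norm_e :
  \sum_i Num.min (kappa / (2 * p%:R) * data_norm2 betastar sigma (e i)) 1 <= s4.
Hypothesis net_sq : forall k l : K,
  \sum_i Num.min ((Num.sqrt kappa * sc (ball_grid R k) (ball_grid R l) (e i)) ^+ 2) 1 <= s4.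
Hypothesis net_clip : forall k l : K,
  `|\sum_i clip (Num.sqrt kappa * sc (ball_grid R k) (ball_grid R l) (e i))| <= s4.

Let pR : 1 <= p%:R :> R. Proof. by rewrite ler1n. Qed.
Let NR : 0 < N%:R :> R. Proof. by rewrite ltr0n. Qed.

Let J := [set i | data_norm2 betastar sigma (e i) <= 2 * p%:R / kappa]%SET.

Let cardJ : #|~: J|%:R <= s4.
Proof.
apply: le_trans norm_e; rewrite -sum1_card natr_sum.
have r0 i : 0 <= kappa / (2 * p%:R) * data_norm2 betastar sigma (e i).
  by rewrite mulr_ge0 ?data_norm2_ge0// divr_ge0 ?mulr_ge0// ltW.
rewrite [leRHS](bigID (mem (~: J)))/= -[leLHS]addr0; apply: lerD; last first.
  by apply: sumr_ge0 => i _; rewrite le_min r0 ler01.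
apply: ler_sum => i; rewrite !inE -ltNge => h.
rewrite le_min lexx andbT mulrAC ler_pdivlMr ?mulr_gt0 ?(lt_le_trans ltr01 pR)//.
by move: h; rewrite mul1r ltr_pdivrMr// [data_norm2 _ _ _ * _]mulrC => /ltW.
Qed.

(** The score is of degree two in the data and of degree one in each
    direction; [fine_grid] matches the grid spacing to the square of the largest
    admissible size of the data. *)
Let score_near (a a' v v' : 'cV[R]_p) i : i \in J ->
  dotv a a <= 1 -> dotv a' a' <= 1 -> dotv v v <= 1 -> dotv v' v' <= 1 ->
  dotv (a - a') (a - a') <= p%:R / N%:R ^+ 2 ->
  dotv (v - v') (v - v') <= p%:R / N%:R ^+ 2 ->
  `|Num.sqrt kappa * sc a v (e i) - Num.sqrt kappa * sc a' v' (e i)| <= kappa.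
Proof.
rewrite inE => he a1 a'1 v1 v'1 da dv.
have := fine_grid; set zeta := Num.sqrt p%:R / N%:R; set r := 2 * p%:R / kappa in he * => fg.
have zeta0 : 0 <= zeta by rewrite divr_ge0 ?sqrtr_ge0.
have r1 : 1 <= r by rewrite ler_pdivlMr//; move: pR kappa1; lra.
have r0 : 0 <= r by apply: le_trans ler01 r1.
have small (u : 'cV[R]_p) : dotv u u <= p%:R / N%:R ^+ 2 -> norm2 u <= zeta.
  move=> h; have -> : zeta = Num.sqrt (p%:R / N%:R ^+ 2).
    by rewrite sqrtrM// -exprVn sqrtr_sqr ger0_norm// invr_ge0 ltW.
  by rewrite ler_wsqrtr.
have unit (u : 'cV[R]_p) : dotv u u <= 1 -> norm2 u <= 1.
  by move=> h; rewrite -sqrtr1 ler_wsqrtr.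
have xr : norm2 (colv (e i).1) <= Num.sqrt r.
  rewrite ler_wsqrtr//; apply: le_trans he; by rewrite lerDl sqr_ge0.
have nr : `|ns (e i)| <= Num.sqrt r.
  rewrite -sqrtr_sqr ler_wsqrtr//; apply: le_trans he; by rewrite lerDr dotv_ge0.
have bd (u v0 : 'cV[R]_p) A B : norm2 u <= A -> norm2 v0 <= B -> `|dotv u v0| <= A * B.
  by move=> hu hv; apply: le_trans (abs_dotv_le _ _) _; rewrite ler_pM ?norm2_ge0.
have sr : Num.sqrt r ^+ 2 = r by rewrite sqr_sqrtr.
have hd : sc a v (e i) - sc a' v' (e i) =
    K1 * dotv (colv (e i).1) (a - a') * dotv (colv (e i).1) v
    + (K1 * dotv (colv (e i).1) a' + ns (e i)) * dotv (colv (e i).1) (v - v')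
    - K1 * dotv (a - a') v - K1 * dotv a' (v - v').
  by rewrite /score !(dotvBr, dotvBl); ring.
have t1 : `|K1 * dotv (colv (e i).1) (a - a') * dotv (colv (e i).1) v| <= K1 * r * zeta.
  rewrite !normrM (gtr0_norm K10).
  have := bd _ _ _ _ xr (small _ da); have := bd _ _ _ _ xr (unit _ v1).
  rewrite mulr1 => h1 h2; rewrite -mulrA -mulrA ler_wpM2l ?(ltW K10)//.
  apply: le_trans (ler_pM _ _ h2 h1) _ => //.
  by rewrite mulrAC -expr2 sr.
have t2 : `|(K1 * dotv (colv (e i).1) a' + ns (e i)) * dotv (colv (e i).1) (v - v')|
    <= (K1 + 1) * r * zeta.
  rewrite normrM; have h1 := bd _ _ _ _ xr (small _ dv).
  have h2 : `|K1 * dotv (colv (e i).1) a' + ns (e i)| <= (K1 + 1) * Num.sqrt r.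
    apply: le_trans (ler_normD _ _) _; rewrite mulrDl mul1r lerD// normrM (gtr0_norm K10).
    by rewrite ler_wpM2l ?(ltW K10)//; have := bd _ _ _ _ xr (unit _ a'1); rewrite mulr1.
  apply: le_trans (ler_pM _ _ h2 h1) _ => //.
  by rewrite mulrA -[_ * _ * Num.sqrt r]mulrA -expr2 sr.
have t3 : `|K1 * dotv (a - a') v| <= K1 * r * zeta.
  rewrite normrM (gtr0_norm K10) -mulrA ler_wpM2l ?(ltW K10)//.
  apply: le_trans (bd _ _ _ _ (small _ da) (unit _ v1)) _.
  by rewrite mulr1 ler_peMl.
have t4 : `|K1 * dotv a' (v - v')| <= K1 * r * zeta.
  rewrite normrM (gtr0_norm K10) -mulrA ler_wpM2l ?(ltW K10)//.
  apply: le_trans (bd _ _ _ _ (unit _ a'1) (small _ dv)) _.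
  by rewrite mul1r ler_peMl.
have tot : `|sc a v (e i) - sc a' v' (e i)| <= (4 * K1 + 1) * zeta * r.
  rewrite hd; apply: le_trans (ler_normB _ _) _.
  apply: le_trans (lerD (ler_normB _ _) (lexx _)) _.
  apply: le_trans (lerD (lerD (ler_normD _ _) (lexx _)) (lexx _)) _.
  by lra.
rewrite -mulrBr normrM ger0_norm ?sqrtr_ge0//.
rewrite -[leRHS](sqr_sqrtr (ltW kappa0)) expr2 ler_wpM2l ?sqrtr_ge0//.
exact: le_trans tot fg.
Qed.

Lemma uniform_truncated (a v : 'cV[R]_p) : dotv a a <= 1 -> dotv v v <= 1 ->
  \sum_i Num.min ((Num.sqrt kappa * sc a v (e i)) ^+ 2) 1 <= 14 * M * kappa * n%:R /\
  `|\sum_i clip (Num.sqrt kappa * sc a v (e i))| <= 14 * M * kappa * n%:R.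
Proof.
move=> a1 v1.
have [k hk] := ball_grid_approx N0 a1; have [l hl] := ball_grid_approx N0 v1.
have nr i : i \in J -> _ := fun iJ => score_near iJ a1 (@ball_grid_le1 R p N k) v1
   (@ball_grid_le1 R p N l) hk hl.
have nn : 0 <= n%:R :> R by rewrite ler0n.
have kn : kappa * n%:R <= M * kappa * n%:R by rewrite -mulrA ler_peMl ?mulr_ge0 ?(ltW kappa0).
have kkn : kappa ^+ 2 * n%:R <= kappa * n%:R.
  by rewrite ler_wpM2r// expr2 ler_piMl ?(ltW kappa0).
have nE : \sum_(i < n) kappa = kappa * n%:R by rewrite sumr_const card_ord mulr_natr.
have Jc (c : R) : 0 <= c -> \sum_i (i \notin J)%:R * c <= s4 * c.
  move=> c0; rewrite -mulr_suml ler_wpM2r//; apply: le_trans cardJ.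
  rewrite -sum1_card natr_sum [leRHS]big_mkcond/=; apply: ler_sum => i _.
  by rewrite finset.in_setC; case: (i \in J).
split.
  have H i : Num.min ((Num.sqrt kappa * sc a v (e i)) ^+ 2) 1 <=
     (i \notin J)%:R * 1 + (2 * Num.min ((Num.sqrt kappa *
         sc (ball_grid R k) (ball_grid R l) (e i)) ^+ 2) 1 + 2 * kappa ^+ 2).
    have [iJ|iJ] := boolP (i \in J); last first.
      rewrite mul1r ge_min; apply/orP; right; rewrite lerDl.
      by rewrite addr_ge0// mulr_ge0 ?sqr_ge0// le_min sqr_ge0 ler01.
    rewrite mul0r add0r; have := nr _ iJ; move: (Num.sqrt kappa * sc a v (e i))
      (Num.sqrt kappa * sc (ball_grid R k) (ball_grid R l) (e i)) => X Y hXY.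
    have hXY2 : (X - Y) ^+ 2 <= kappa ^+ 2.
      rewrite -[leLHS]real_normK ?num_real// ler_sqr ?nnegrE//.
      exact: ltW.
    have hX : X ^+ 2 <= 2 * Y ^+ 2 + 2 * kappa ^+ 2.
      by have := sqr_ge0 (X - 2 * Y); nra.
    have [h|h] := leP (Y ^+ 2) 1; first by rewrite ge_min hX.
    rewrite ge_min; apply/orP; right; have := sqr_ge0 kappa; lra.
  apply: le_trans (ler_sum _ (fun i _ => H i)) _.
  rewrite !big_split/= -!mulr_sumr sumr_const card_ord -mulr_natr.
  by have := Jc 1 ler01; have := net_sq k l; lra.
have H i : `|clip (Num.sqrt kappa * sc a v (e i)) - clip (Num.sqrt kappa *
         sc (ball_grid R k) (ball_grid R l) (e i))| <= (i \notin J)%:R * 2 + kappa.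
  have [iJ|iJ] := boolP (i \in J); last first.
    apply: le_trans (ler_normB _ _) _.
    move: (clip_le1 (Num.sqrt kappa * sc a v (e i)))
      (clip_le1 (Num.sqrt kappa * sc (ball_grid R k) (ball_grid R l) (e i))).
    by rewrite mul1r; have := ltW kappa0; lra.
  rewrite mul0r add0r; apply: le_trans (clip_lipschitz _ _) _; exact: nr.
have D : `|\sum_i clip (Num.sqrt kappa * sc a v (e i)) -
     \sum_i clip (Num.sqrt kappa * sc (ball_grid R k) (ball_grid R l) (e i))|
     <= s4 * 2 + kappa * n%:R.
  rewrite -sumrB; apply: le_trans (ler_norm_sum _ _ _) _.
  apply: le_trans (ler_sum _ (fun i _ => H i)) _.
  by rewrite big_split/= nE lerD2r; apply: Jc.
have := net_clip k l; move: D; rewrite !ler_norml => /andP[? ?] /andP[? ?].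
by apply/andP; split; lra.
Qed.

End transfer.

(** * Integrating out the randomness of the filter *)

Import HBNNSimple.

(** The integrand of the product measure is not measurable in general, but its
    integral is a supremum over simple functions below it, and beta times the
    indicator of [G] is one of them. *)
Lemma product_measure_ge d1 d2 (Omega : measurableType d1)
    (Rnd : measurableType d2) (R : realType) (P : probability Omega R)
    (Q : probability Rnd R) (B : set (Omega * Rnd)) (G : set Omega) (alpha beta : R) :
  measurable G -> 0 <= beta -> (alpha%:E <= P G)%E ->
  (forall w, G w -> beta%:E <= Q (xsection B w))%E ->
  ((beta * alpha)%:E <= (P \x Q) B)%E.
Proof.
move=> mG b0 aG hG.
have f0 w : (0 <= (Q \o xsection B) w)%E by exact: measure_ge0.
pose h : {nnsfun Omega >-> R} := scale_nnsfun (indic_nnsfun R mG) b0.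
apply: (@le_trans _ _ (sintegral P h)).
  rewrite -integralT_nnsfun.
  rewrite (_ : (fun x => _) = (fun x => beta%:E * (\1_G x)%:E))%E //.
  rewrite ge0_integralZl//; last exact/measurable_EFinP.
  by rewrite integral_indic// setIT EFinM lee_wpmul2l ?lee_fin.
rewrite /product_measure1 ge0_integralTE//.
apply: ereal_sup_ubound; exists h => // w.
change ((beta * \1_G w)%:E <= Q (xsection B w))%E; rewrite indicE; have [Gw|nGw] := pselect (G w).
  by rewrite mem_set// mulr1; exact: hG.
by rewrite memNset// mulr0.
Qed.

(** The output ranges over the finitely many sub-multisets of the input, and
    each value is taken on a measurable event. *)
Lemma filter_measurable (R : realType) (dr : measure_display)
    (Rnd : measurableType dr) (Q : probability Rnd R) (Filter : algorithm R Rnd)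
    p (T : {mset 'cV[R]_p}) (eps : R) (S : set {mset 'cV[R]_p}) :
  is_filter Q Filter -> 0 < eps -> eps < 1 / 2 ->
  measurable [set r | S (Filter p T eps r)].
Proof.
move=> [sub mF _] e0 e1.
rewrite (_ : [set r | _] = \bigcup_(m in [set: (size T).-tuple bool])
    [set r | Filter p T eps r = seq_mset (mask m T) /\ S (seq_mset (mask m T))]).
  apply: fin_bigcup_measurable => // m _.
  have [hS|hS] := pselect (S (seq_mset (mask m T))).
    rewrite (_ : [set r | _] = [set r | Filter p T eps r = seq_mset (mask m T)]).
      exact: mF.
    by apply/seteqP; split => r /=; [case|].
  rewrite (_ : [set r | _] = set0) //.
  by rewrite -subset0 => r /= [].
apply/seteqP; split => r /=; last by move=> [m _ [-> ]].
move=> hS; have := sub p T eps r e0 e1.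
rewrite -[X in (_ `<=` X)%mset](seq_mset_id T) => /msubset_subseq[t /subseqP[m sm tE] Ft].
exists (Tuple (introT eqP sm)) => //=.
suff E : Filter p T eps r = seq_mset (mask m T) by rewrite -E.
rewrite -tE -[LHS]seq_mset_id; exact/eq_seq_msetP.
Qed.

(** * Stability of the gradients *)

Lemma gradient_step_sample (R : realType) (p n : nat) (Omega : Type)
    (betastar b : 'cV[R]_p) (x : 'I_n -> Omega -> p.-tuple R)
    (z : 'I_n -> Omega -> R) (w : Omega) :
  gradient_step b (sample betastar x z w) =
  seq_mset [seq b + (response betastar x z i w - dotv (colv (x i w)) b)
                 *: colv (x i w) | i <- enum 'I_n].
Proof.
apply/eq_seq_msetP; rewrite (perm_trans (perm_map _ (perm_eq_seq_mset _)))//.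
by rewrite -map_comp.
Qed.

Lemma sqrt_subadd (R : realType) (a b : R) : 0 <= a -> 0 <= b ->
  Num.sqrt (a + b) <= Num.sqrt a + Num.sqrt b.
Proof.
move=> a0 b0; rewrite -ler_sqr ?nnegrE ?addr_ge0 ?sqrtr_ge0//.
rewrite sqrrD !sqr_sqrtr ?addr_ge0// addrAC lerDl.
by rewrite mulrn_wge0// mulr_ge0 ?sqrtr_ge0.
Qed.

(** Here B kappa is the corruption level, Lam and bet are the bounds on the
    second and first moments after pruning, and [D] is the constant in
    delta = D sqrt eps. *)
Lemma stability_constants (R : realType) (B Lam bet C0 D kappa eps : R) :
  1 <= B -> 0 <= Lam -> 0 <= bet -> 1 < C0 -> 0 < kappa -> eps = B * kappa ->
  C0 * eps < 1 / 2 ->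
  4 * (bet + Num.sqrt (C0 * Lam)) <= D -> C0 * (4 * Lam + 1) <= D ->
  [/\ C0 * eps <= D * Num.sqrt eps,
      4 * (bet * Num.sqrt kappa + Num.sqrt (C0 * eps * Lam)) <= D * Num.sqrt eps,
      (4 * Lam + 1) * (C0 * eps) <= (D * Num.sqrt eps) ^+ 2 &
      eps < 1 / 2].
Proof.
move=> B1 Lam0 bet0 C01 k0 epsE eps2 hD1 hD2.
have C0pos : 0 < C0 by apply: lt_trans C01.
have eps0 : 0 < eps by rewrite epsE mulr_gt0// (lt_le_trans ltr01 B1).
have epsh : eps < 1 / 2 by apply: le_lt_trans eps2; rewrite ler_peMl ?(ltW eps0)// ltW.
have se0 : 0 < Num.sqrt eps by rewrite sqrtr_gt0.
have se2 : Num.sqrt eps ^+ 2 = eps by rewrite sqr_sqrtr ?(ltW eps0).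
have se1 : Num.sqrt eps <= 1.
  rewrite -sqrtr1 ler_wsqrtr//; apply: ltW; apply: lt_trans epsh _.
  by rewrite ltr_pdivrMr// mul1r ltr1n.
have q1 : 1 <= 4 * Lam + 1 by rewrite lerDr mulr_ge0.
have C0D : C0 <= D by apply: le_trans hD2; rewrite ler_peMr// ltW.
have D0 : 0 < D by apply: lt_le_trans C0D.
split => //.
- rewrite -{1}se2 expr2 mulrA ler_pM2r//.
  by apply: le_trans C0D; rewrite ler_piMr// ltW.
- have ke : Num.sqrt kappa <= Num.sqrt eps.
    by rewrite ler_wsqrtr// epsE ler_peMl ?(ltW k0).
  have -> : Num.sqrt (C0 * eps * Lam) = Num.sqrt (C0 * Lam) * Num.sqrt eps.
    by rewrite -sqrtrM ?mulr_ge0 ?(ltW C0pos)//; congr Num.sqrt; ring.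
  apply: le_trans (ler_wpM2r (ltW se0) hD1).
  by rewrite -mulrA ler_wpM2l// mulrDl lerD2r ler_wpM2l.
- rewrite exprMn se2 mulrA ler_wpM2r ?(ltW eps0)//.
  rewrite mulrC; apply: le_trans hD2 _; rewrite expr2 ler_peMl ?(ltW D0)//.
  by apply: le_trans C0D; exact: ltW.
Qed.

Section pruned_gradients.
Context (R : realType) (p n : nat) (betastar b : 'cV[R]_p) (sigma K1 kappa L : R).
Context (e : 'I_n -> p.-tuple R * R).
Hypotheses (p0 : (0 < p)%N) (n0 : (0 < n)%N) (K10 : 0 < K1) (sigma0 : 0 <= sigma).
Hypotheses (kappa0 : 0 < kappa) (L1 : 1 <= L).
Notation sc := (score betastar sigma K1).
Hypothesis noise_ok : forall i,
  (e i).2 - dotv (colv (e i).1) betastar = sigma * noise betastar sigma (e i).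
Hypothesis near_b : norm2 (b - betastar) <= K1 * sigma.
Hypothesis truncated : forall a v : 'cV[R]_p, dotv a a <= 1 -> dotv v v <= 1 ->
  \sum_i Num.min ((Num.sqrt kappa * sc a v (e i)) ^+ 2) 1 <= L * kappa * n%:R /\
  `|\sum_i clip (Num.sqrt kappa * sc a v (e i))| <= L * kappa * n%:R.

Let pt i : 'cV[R]_p := b + ((e i).2 - dotv (colv (e i).1) b) *: colv (e i).1.

(** The vectors are pruned after scaling by sqrt kappa, with
    s = L kappa n; the constants 16, 100 and 117 come from there. *)
Lemma stable_gradients (C0 D : R) : 1 < C0 ->
  4 * (117 * L + Num.sqrt (C0 * (100 * L))) <= D ->
  C0 * (4 * (100 * L) + 1) <= D ->
  C0 * (16 * L * kappa) < 1 / 2 ->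
  exists J : {set 'I_n},
    (1 - 16 * L * kappa) * n%:R <= #|J|%:R /\
    stable (C0 * (16 * L * kappa)) (D * Num.sqrt (16 * L * kappa))
      (seq_mset [seq pt i | i <- enum J]) betastar sigma.
Proof.
move=> C01 hD1 hD2 eps2.
set eps := 16 * L * kappa in eps2 *.
have nR : 0 < n%:R :> R by rewrite ltr0n.
have Lpos : 0 < L by apply: lt_le_trans L1.
have C0pos : 0 < C0 by apply: lt_trans C01.
have eps0 : 0 < eps by rewrite !mulr_gt0 ?ltr0n.
have [a a1 ab] : exists2 a, dotv a a <= 1 & betastar - b = (K1 * sigma) *: a.
  have near2 : dotv (betastar - b) (betastar - b) <= (K1 * sigma) ^+ 2.
    rewrite -opprB; have -> (u : 'cV[R]_p) : dotv (- u) (- u) = dotv u u.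
      by rewrite dotvNr dotvC dotvNr opprK.
    by rewrite -norm2_sqr ler_sqr ?nnegrE ?norm2_ge0 ?mulr_ge0 ?(ltW K10).
  have [s0|s0] := eqVneq sigma 0.
    exists 0; first by rewrite dotv0r ler01.
    rewrite scaler0; apply: dotv_eq0; apply/eqP; rewrite eq_le dotv_ge0 andbT.
    by apply: le_trans near2 _; rewrite s0 mulr0 expr0n.
  have Ks : 0 < K1 * sigma by rewrite mulr_gt0// lt_def s0.
  exists ((K1 * sigma)^-1 *: (betastar - b)); last first.
    by rewrite scalerA mulfV ?scale1r// gt_eqF.
  by rewrite dotvZl dotvZr mulrA -expr2 exprVn mulrC ler_pdivrMr ?exprn_gt0// mul1r.
pose h i : 'cV[R]_p := (K1 * dotv (colv (e i).1) a + noise betastar sigma (e i))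
    *: colv (e i).1 - K1 *: a.
have hE i v : dotv (h i) v = sc a v (e i).
  by rewrite /h /score dotvBl !dotvZl.
have ptE i : pt i = betastar + sigma *: h i.
  rewrite /h scalerBr !scalerA mulrDr -noise_ok.
  have -> : sigma * (K1 * dotv (colv (e i).1) a) = dotv (colv (e i).1) (betastar - b).
    by rewrite ab dotvZr; ring.
  rewrite (mulrC sigma) -ab /pt dotvBr.
  rewrite (_ : dotv _ betastar - dotv _ b + _ = (e i).2 - dotv (colv (e i).1) b); last by ring.
  by rewrite opprB addrCA [betastar + _]addrC subrK addrC.
pose s := L * kappa * n%:R.
have s0 : 0 < s by rewrite !mulr_gt0.
have [||J [hJ hJ2]] := @exists_pruned_subset R p _ (fun i => Num.sqrt kappa *: h i) s s0.
- move=> v v1; have [H _] := truncated a1 v1; apply: le_trans H.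
  by apply: ler_sum => i _; rewrite dotvZl hE.
- move=> v v1; have [_ H] := truncated a1 v1; apply: le_trans H.
  by rewrite le_eqVlt; apply/orP; left; apply/eqP; congr `|_|; apply: eq_bigr => i _; rewrite dotvZl hE.
have B1 : 1 <= 16 * L by rewrite mulr_ege1// ler1n.
have Lam0 : 0 <= 100 * L by rewrite mulr_ge0 ?ler0n ?(ltW Lpos).
have bet0 : 0 <= 117 * L by rewrite mulr_ge0 ?ler0n ?(ltW Lpos).
have [h1 h2 h3 eps1] := stability_constants B1 Lam0 bet0 C01 kappa0 (erefl : eps = _) eps2 hD1 hD2.
exists J.
have cJ : #|J|%:R + #|~: J|%:R = n%:R :> R by rewrite -natrD cardsC card_ord.
have JB : #|~: J|%:R <= eps * n%:R.
  by apply: le_trans hJ _; rewrite /s /eps le_eqVlt; apply/orP; left; apply/eqP; ring.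
have JB2 : (1 - eps) * n%:R <= #|J|%:R by rewrite mulrBl mul1r -cJ lerBlDr lerD2l cJ.
split => //.
have sk0 : 0 < Num.sqrt kappa by rewrite sqrtr_gt0.
have sk2 : Num.sqrt kappa ^+ 2 = kappa by rewrite sqr_sqrtr ?(ltW kappa0).
apply: (stable_image n0 p0 sigma0 _ eps2 h1 _ ptE _ _ _ h2 h3).
- by rewrite mulr_gt0.
- exact: Lam0.
- apply: (@le_trans _ _ (2 * ((1 - eps) * n%:R))); last by rewrite ler_pM2l.
  rewrite mulrA ler_peMl ?(ltW nR)// mulrBr mulr1 lerBrDr -[leRHS]/(1 + 1) lerD2l.
  by rewrite mulrC -ler_pdivlMr// ltW.
- move=> v v1; have [H _] := hJ2 v v1.
  rewrite -(ler_pM2l kappa0); apply: le_trans (le_trans _ H) _; last first.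
    by rewrite /s le_eqVlt; apply/orP; left; apply/eqP; ring.
  rewrite mulr_sumr le_eqVlt; apply/orP; left; apply/eqP; apply: eq_bigr => i _.
  by rewrite dotvZl exprMn sk2.
- move=> v v1; have [_ H] := hJ2 v v1.
  rewrite -(ler_pM2l sk0); apply: le_trans (le_trans _ H) _; last first.
    rewrite /s le_eqVlt; apply/orP; left; apply/eqP.
    by rewrite -[in LHS]sk2; ring.
  rewrite -{1}(gtr0_norm sk0) -normrM mulr_sumr le_eqVlt; apply/orP; left; apply/eqP.
  by congr `|_|; apply: eq_bigr => i _; rewrite dotvZl.
Qed.

End pruned_gradients.

(** * Choice of constants *)

(** Here c is the size of the grid, u = p log (p n) and l = log (1 / tau). *)
Lemma union_failure (R : realType) (c u l X : R) :
  0 <= c -> c <= expR (4 * u) -> 2 <= expR u -> 0 <= l -> 10 * (l + u) <= X ->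
  (1 + 3 * c ^+ 2) * expR (- X) <= expR (- l).
Proof.
move=> c0 cu u2 l0 hX.
have h1 : 1 + 3 * c ^+ 2 <= expR (10 * u).
  have -> : 10 * u = 4 * u + 4 * u + u + u by ring.
  rewrite !expRD; have c1 : 1 <= expR (4 * u).
    rewrite -expR0 ler_expR; apply: mulr_ge0 => //.
    by rewrite leNgt -expR_lt1 -leNgt; lra.
  move: (expR (4 * u)) (expR u) c1 cu u2 => E U c1 cu u2.
  have : c ^+ 2 <= E * E by rewrite expr2 ler_pM.
  have : 1 <= E * E by rewrite -[leLHS]mulr1 ler_pM.
  have : 4 <= U * U by have -> : 4 = 2 * 2 :> R by [ring]; rewrite ler_pM.
  rewrite -mulrA; move: (E * E) (U * U) => F W; nra.
apply: (@le_trans _ _ (expR (10 * u) * expR (- X))).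
  by rewrite ler_wpM2r// expR_ge0.
by rewrite -expRD ler_expR; lra.
Qed.

Lemma filter_failure (R : realType) (A l Y : R) :
  0 <= A -> 1 / 2 <= l -> (1 + 2 * A) * l <= Y -> A * expR (- Y) <= expR (- l).
Proof.
move=> A0 l1 hY.
apply: (@le_trans _ _ (expR (2 * A * l) * expR (- Y))); last first.
  by rewrite -expRD ler_expR; nra.
rewrite ler_wpM2r ?expR_ge0//.
apply: (@le_trans _ _ (expR A)); first by have := expR_ge1Dx A; lra.
by rewrite ler_expR; nra.
Qed.

Lemma card_grid (R : realType) (p q : nat) : (0 < p)%N -> (3 <= q)%N ->
  (#|{: {ffun 'I_p -> bool * 'I_(q ^ 3).+1}}|%:R : R)
    <= expR (4 * (p%:R * ln q%:R)).
Proof.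
move=> p0 q3.
rewrite card_ffun card_prod card_bool !card_ord.
have q0 : (0 < q%:R :> R) by rewrite ltr0n (leq_trans _ q3).
have -> : 4 * (p%:R * ln q%:R) = (4 * p)%:R * ln q%:R :> R by rewrite natrM mulrA.
rewrite expRM_natl lnK// -natrX ler_nat expnM leq_exp2r//.
rewrite (expnS q 3) (@leq_trans (3 * q ^ 3))// ?leq_mul2r ?q3 ?orbT//.
have : (8 <= q ^ 3)%N by rewrite (@leq_trans (3 ^ 3))// leq_exp2r.
by rewrite mulnS [(3 * _)%N]mulSn leq_add2r => /(leq_trans _); apply.
Qed.

Lemma fine_grid_bound (R : realType) (p n : nat) (K1 kappa : R) :
  (0 < p)%N -> (0 < n)%N -> 0 < K1 -> 2 * (4 * K1 + 1) <= n%:R ->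
  1 <= n%:R * kappa ->
  (4 * K1 + 1) * (Num.sqrt p%:R / ((p * n) ^ 3)%:R) * (2 * p%:R / kappa)
    <= Num.sqrt kappa.
Proof.
move=> p0 n0 K10 hn hk.
have p1 : 1 <= p%:R :> R by rewrite ler1n.
have n1 : 1 <= n%:R :> R by rewrite ler1n.
have pR : 0 < p%:R :> R by rewrite ltr0n.
have nR : 0 < n%:R :> R by rewrite ltr0n.
have k0 : 0 < kappa by rewrite -(pmulr_rgt0 _ nR) (lt_le_trans ltr01).
have ik : kappa^-1 <= n%:R by rewrite -(ler_pM2r k0) mulVf ?gt_eqF.
have sk : n%:R^-1 <= Num.sqrt kappa.
  rewrite -(@ger0_norm _ (n%:R^-1 : R)) ?invr_ge0 ?ler0n// -sqrtr_sqr ler_wsqrtr//.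
  rewrite exprVn -(ler_pM2l (exprn_gt0 2 nR)) mulfV ?expf_neq0 ?gt_eqF//.
  by rewrite expr2 -mulrA (le_trans hk)// ler_peMl// (le_trans ler01).
have sp : Num.sqrt p%:R <= p%:R :> R.
  rewrite -[leRHS]ger0_norm ?ler0n// -sqrtr_sqr ler_wsqrtr//.
  by rewrite expr2 ler_peMl ?ler0n.
apply: le_trans sk.
have K4 : 0 <= 4 * K1 + 1 by rewrite addr_ge0// mulr_ge0// ltW.
have inv0 : 0 <= (((p * n) ^ 3)%:R)^-1 :> R by rewrite invr_ge0 ler0n.
apply: (@le_trans _ _ ((4 * K1 + 1) * (p%:R / ((p * n) ^ 3)%:R) * (2 * p%:R * n%:R))).
  apply: ler_pM.
  - by rewrite mulr_ge0// mulr_ge0 ?sqrtr_ge0.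
  - by rewrite mulr_ge0 ?mulr_ge0 ?ler0n// invr_ge0 ltW.
  - by rewrite ler_wpM2l// ler_wpM2r.
  - by rewrite ler_wpM2l// mulr_ge0 ?ler0n.
rewrite natrX natrM.
have -> : (4 * K1 + 1) * (p%:R / (p%:R * n%:R) ^+ 3) * (2 * p%:R * n%:R)
   = (2 * (4 * K1 + 1)) / (p%:R * n%:R * n%:R).
  by field; rewrite !gt_eqF.
rewrite ler_pdivrMr ?mulr_gt0// [leRHS](_ : _ = p%:R * n%:R); last first.
  by field; rewrite gt_eqF.
by apply: le_trans hn _; rewrite ler_peMl.
Qed.

Lemma msubset_map_enum (I : finType) (Y : choiceType) (f : I -> Y) (J : {set I}) :
  (seq_mset [seq f i | i <- enum J] `<=` seq_mset [seq f i | i <- enum I])%mset.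
Proof.
apply/msubsetP => y; rewrite !mset_seqE; apply: leq_count_subseq.
by apply: map_subseq; rewrite enumT; exact: filter_subseq.
Qed.

Lemma addends_le (R : realType) (b1 b2 b3 b4 K : R) :
  0 <= b1 -> 0 <= b2 -> 0 <= b3 -> 0 <= b4 -> b1 + b2 + b3 + b4 <= K ->
  [/\ b1 <= K, b2 <= K, b3 <= K & b4 <= K].
Proof. by move=> *; split; lra. Qed.

Lemma sample_size_facts (R : realType) (n : nat) (K C0 eps l u eps' : R) :
  (0 < n)%N -> 1 <= K -> 1 < C0 -> 0 <= eps -> 1 / 2 <= l -> 0 <= u ->
  eps' = K * (eps + l / n%:R + u / n%:R) -> eps' < 1 / (2 * C0) ->
  [/\ 0 < eps', C0 * eps' < 1 / 2, eps' < 1 / 2, eps <= eps' &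
      K * (l + u) <= n%:R * eps' /\ K <= n%:R].
Proof.
move=> n0 K1 C01 e0 l2 u0 epsE epsC.
have nR : 0 < n%:R :> R by rewrite ltr0n.
have K0 : 0 < K by apply: lt_le_trans K1.
have C0p : 0 < C0 by apply: lt_trans C01.
have l0 : 0 < l by apply: lt_le_trans l2; rewrite divr_gt0.
have nE : n%:R * eps' = K * (n%:R * eps + l + u).
  by rewrite epsE; field; rewrite gt_eqF.
have h1 : K * (l + u) <= n%:R * eps'.
  by rewrite nE ler_pM2l// -addrA lerDr mulr_ge0// ltW.
have eps'0 : 0 < eps'.
  rewrite -(pmulr_rgt0 _ nR); apply: lt_le_trans h1.
  by rewrite mulr_gt0// ltr_pwDl.
have C0e : C0 * eps' < 1 / 2.
  move: epsC; rewrite ltr_pdivlMr ?mulr_gt0// => h.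
  by rewrite ltr_pdivlMr//; apply: le_lt_trans h; rewrite le_eqVlt; apply/orP; left; apply/eqP; ring.
have e2 : eps' < 1 / 2 by apply: le_lt_trans C0e; rewrite ler_peMl// ltW.
split=> //.
  rewrite epsE -[leLHS]mul1r ler_pM//.
  by rewrite -addrA lerDl addr_ge0// divr_ge0// ltW.
split=> //; clear -h1 K0 l2 u0 e2 nR.
have : n%:R * eps' <= n%:R * (1 / 2) by rewrite ler_pM2l// ltW.
have : K * (1 / 2) <= K * (l + u) by rewrite ler_pM2l//; lra.
by move: (n%:R) (K * (l + u)) (_ * eps') h1 => t v s h; lra.
Qed.

Lemma sqrt_rate (R : realType) (K a b c : R) :
  0 <= K -> 0 <= a -> 0 <= b -> 0 <= c ->
  Num.sqrt (K * (a + b + c)) <= Num.sqrt K * (Num.sqrt c + Num.sqrt a + Num.sqrt b).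
Proof.
move=> K0 a0 b0 c0; rewrite sqrtrM// ler_wpM2l ?sqrtr_ge0//.
apply: le_trans (sqrt_subadd _ c0) _; first exact: addr_ge0.
by have := sqrt_subadd a0 b0; lra.
Qed.

Lemma expRN_ln_inv (R : realType) (tau : R) : 0 < tau -> expR (- ln (1 / tau)) = tau.
Proof. by move=> t0; rewrite expRN lnK ?div1r ?invrK// posrE invr_gt0. Qed.

Lemma ln_inv_ge_half (R : realType) (tau : R) : 0 < tau -> tau < 1 / 2 ->
  1 / 2 <= ln (1 / tau).
Proof.
move=> t0 t2; rewrite -ler_expR lnK ?posrE ?divr_gt0//.
apply: (@le_trans _ _ (1 + 1)); first exact: expR_half_le.
by rewrite ler_pdivlMr//; lra.
Qed.

(** A stable multiset is one of its own large sub-multisets. *)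
Lemma filter_mean_ge (R : realType) (dr : measure_display)
    (Rnd : measurableType dr) (Q : probability Rnd R) (Filter : algorithm R Rnd)
    (p : nat) (T : {mset 'cV[R]_p})
    (eps' delta sigma c1 c2 c3 C0 prob rate : R) (mu : 'cV[R]_p) :
  is_filter Q Filter -> 0 < eps' -> eps' < 1 / 2 ->
  (prob%:E <= Q [set r | ((1 - c1 * eps') * (size T)%:R
                         <= (size (Filter p T eps' r))%:R)%R /\
                       stable (c2 * C0 * eps')%R (c3 * delta)%R
                         (Filter p T eps' r) mu sigma])%E ->
  sigma * (c3 * delta) <= rate ->
  (prob%:E <= Q [set r | (norm2 (mean (Filter p T eps' r) - mu) <= rate)%R])%E.
Proof.
move=> hFilter eps'0 eps'1 guarantee hrate.
apply: le_trans guarantee _; apply: le_measure.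
- rewrite inE.
  apply: (filter_measurable T (fun U => (1 - c1 * eps') * (size T)%:R <= (size U)%:R /\
    stable (c2 * C0 * eps') (c3 * delta) U mu sigma) hFilter) => //.
- rewrite inE.
  apply: (filter_measurable T (fun U => norm2 (mean U - mu) <= rate) hFilter) => //.
move=> r [_ [e0 _ _ /(_ _ (msubset_refl _))]] /= [].
  by rewrite ler_piMl// gerBl ltW.
by move=> h _; apply: le_trans hrate.
Qed.

(* The data live on (Omega, P) and the internal randomness of the filter on
   (Rnd, Q).  The estimator beta1 and the adversary T are arbitrary, possibly
   non-measurable, functions of w: (P \x Q) B unfolds to the integral over w
   of Q (xsection B w), which is a lower integral when the integrand is not
   measurable, so the bound below is meaningful (and strongest) in that case. *)
Theorem theorem6p3 (R : realType) (dr : measure_display)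
    (Rnd : measurableType dr) (Q : probability Rnd R)
    (Filter : algorithm R Rnd) (hFilter : is_filter Q Filter)
    (C K1 : R) (hC : 0 < C) (hK1 : 0 < K1) :
  exists Kmin c0 : R, [/\ 0 < Kmin, 0 < c0 &
  forall K : R, Kmin <= K ->
  exists K2 : R, 0 < K2 /\
  forall (p n : nat) (d : measure_display) (Omega : measurableType d)
    (P : probability Omega R) (betastar : 'cV[R]_p)
    (x : 'I_n -> {RV P >-> p.-tuple R}) (z : 'I_n -> {RV P >-> R})
    (sigma4 sigma eps tau : R)
    (beta1 : Omega -> 'cV[R]_p) (T : Omega -> {mset ('cV[R]_p * R)%type}),
    (0 < p)%N -> (0 < n)%N -> 0 <= sigma -> 0 <= eps -> 0 < tau -> tau < 1 ->
    sigma4 <= C ->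
    linear_model betastar x z sigma4 sigma ->
    (forall w, norm2 (beta1 w - betastar) <= K1 * sigma) ->
    (forall w, corrupted eps (sample betastar x z w) (T w)) ->
    let eps' := K * (eps + ln (1 / tau) / n%:R
                     + p%:R * ln (p * n)%:R / n%:R) in
    eps' < c0 ->
    ((1 - 2 * tau)%:E <=
     (P \x Q) [set wr : Omega * Rnd |
       (norm2 (mean (Filter p (gradient_step (beta1 wr.1) (T wr.1)) eps' wr.2)
               - betastar)
        <= K2 * (sigma * (Num.sqrt (p%:R * ln (p * n)%:R / n%:R)
                          + Num.sqrt eps
                          + Num.sqrt (ln (1 / tau) / n%:R))))%R])%E].
Proof.
have [_ _ [c1 [c2 [c3 [Cmin [c10 c20 c30 hC0]]]]]] := hFilter.
pose C0 := 2 + `|Cmin|.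
have C01 : 1 < C0 by rewrite /C0; have := normr_ge0 Cmin; lra.
have CminC0 : Cmin <= C0 by rewrite /C0; have := ler_norm Cmin; lra.
have [A [a [A0 a0 guarantee]]] := hC0 C0 C01 CminC0.
pose M := score_var C K1.
have M1 : 1 <= M := score_var_ge1 K1 hC.
(* 14 is the constant of [uniform_truncated]. *)
pose L := 14 * M.
have L1 : 1 <= L by rewrite mulr_ege1// ler1n.
have L0 : 0 < L by apply: lt_le_trans L1.
pose D := 4 * (117 * L + Num.sqrt (C0 * (100 * L))) + C0 * (4 * (100 * L) + 1).
have C0pos : 0 < C0 by apply: lt_trans C01.
have hD1 : 4 * (117 * L + Num.sqrt (C0 * (100 * L))) <= D.
  rewrite /D lerDl; apply: mulr_ge0; first exact: ltW.
  by rewrite addr_ge0// mulr_ge0 ?ler0n// mulr_ge0 ?ler0n// ltW.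
have hD2 : C0 * (4 * (100 * L) + 1) <= D.
  rewrite /D lerDr; apply: mulr_ge0 => //; apply: addr_ge0; last exact: sqrtr_ge0.
  by rewrite mulr_ge0 ?ler0n// ltW.
have D0 : 0 < D.
  apply: lt_le_trans hD2; rewrite mulr_gt0// ltr_wpDl//.
  by do 2 (rewrite mulr_ge0 ?ler0n//); exact: ltW.
(* 2240 = 10 * 224, where 224 = 16 * 14 is the ratio of eps' to M * kappa: the
   grid costs 10 times its logarithmic size. *)
have [k0 k0E] : exists k0 : R, k0 = 2240 by exists 2240.
have t0 : 0 < k0 by rewrite k0E ltr0n.
have t1 : 0 <= 2 * (16 * L) by do 2 (apply: mulr_ge0; first exact: ler0n); exact: ltW.
have t2 : 0 <= 2 * (4 * K1 + 1).
  apply: mulr_ge0; first exact: ler0n.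
  by rewrite addr_ge0// mulr_ge0// ltW.
have t3 : 0 <= (1 + 2 * A) / a.
  by apply: divr_ge0; [rewrite addr_ge0// mulr_ge0// ltW|exact: ltW].
exists (k0 + 2 * (16 * L) + 2 * (4 * K1 + 1) + (1 + 2 * A) / a), (1 / (2 * C0)); split.
- by rewrite -!addrA ltr_pwDl// !addr_ge0.
- by rewrite divr_gt0// mulr_gt0.
move=> K /(addends_le (ltW t0) t1 t2 t3)[Kk0 KL KK1 KA].
have K0 : 0 < K by apply: lt_le_trans Kk0.
exists (c3 * D * Num.sqrt K); split; first by rewrite !mulr_gt0// sqrtr_gt0.
move=> p n d Omega P betastar x z sigma4 sigma eps tau beta1 T p0 n0 sigma0 eps0
  tau0 tau1 s4C model hbeta hT eps' eps'c0.
(* For tau >= 1 / 2 nothing is claimed; otherwise log (1 / tau) >= 1 / 2, which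
   makes n large. *)
have [tau2|tau2] := leP (1 / 2) tau.
  apply: (@le_trans _ _ 0%E); first by rewrite lee_fin subr_le0 mulrC -ler_pdivrMr.
  by apply: integral_ge0 => w _; exact: measure_ge0.
set l := ln (1 / tau) in eps' eps'c0 *.
set u := p%:R * ln (p * n)%:R in eps' eps'c0 *.
have l2 : 1 / 2 <= l by exact: ln_inv_ge_half.
have l0 : 0 <= l by apply: le_trans l2; rewrite divr_ge0.
have u0 : 0 <= u by rewrite mulr_ge0// ln_ge0// ler1n muln_gt0 p0.
have K1' : 1 <= K by apply: le_trans Kk0; rewrite k0E ler1n.
have [eps'0 C0eps eps'1 epsle [nK Kn]] :=
  sample_size_facts n0 K1' C01 eps0 l2 u0 (erefl : eps' = _) eps'c0.
have nR : 0 < n%:R :> R by rewrite ltr0n.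
have n3 : (3 <= n)%N.
  rewrite -(ler_nat R); apply: le_trans Kn; apply: le_trans Kk0.
  by rewrite k0E ler_nat.
have q3 : (3 <= p * n)%N by rewrite (leq_trans n3)// leq_pmull.
pose kappa := eps' / (16 * L).
have L16 : 0 < 16 * L by rewrite mulr_gt0 ?ltr0n.
have kappa0 : 0 < kappa by rewrite divr_gt0.
have epsE : 16 * L * kappa = eps' by rewrite mulrC divfK ?gt_eqF.
have kappa1 : kappa <= 1.
  rewrite ler_pdivrMr// mul1r; apply: (@le_trans _ _ 1).
    by apply: ltW; apply: lt_trans eps'1 _; rewrite ltr_pdivrMr// mul1r ltr1n.
  by rewrite mulr_ege1// ler1n.
have nkappa : 1 <= n%:R * kappa.
  rewrite mulrA ler_pdivlMr// mul1r; apply: le_trans nK.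
  apply: (@le_trans _ _ (K * (1 / 2))).
    by rewrite div1r ler_pdivlMr// mulrC.
  by rewrite ler_pM2l//; apply: le_trans l2 _; rewrite lerDl.
have fg := fine_grid_bound p0 n0 hK1 (le_trans KK1 Kn) nkappa.
(* Spacing (p n)^-3 is fine enough, and costs p log (p n) in the exponent. *)
have [G [mG PG hG]] := good_event K1 ((p * n) ^ 3) p0 hC s4C model kappa0.
have PG' : ((1 - tau)%:E <= P G)%E.
  have : (P (~` G) <= tau%:E)%E.
    apply: le_trans PG _; rewrite lee_fin -[leRHS](expRN_ln_inv tau0).
    apply: (@union_failure _ _ u); rewrite ?ler0n//.
    - exact: card_grid.
    - apply: (@le_trans _ _ (p * n)%:R); first by rewrite ler_nat (leq_trans _ q3).
      rewrite -[leLHS]lnK ?posrE ?ltr0n ?(leq_trans _ q3)// ler_expR ler_peMl ?ler1n//.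
      by rewrite ln_ge0// ler1n muln_gt0 p0.
    - have -> : score_var C K1 * kappa * n%:R = n%:R * eps' / 224.
        rewrite -[LHS](@mulfK _ (224 : R)) ?pnatr_eq0//; congr (_ / _).
        by rewrite -epsE /L /M; ring.
      rewrite ler_pdivlMr ?ltr0n//; apply: le_trans nK.
      rewrite mulrAC ler_wpM2r ?addr_ge0//; apply: le_trans Kk0.
      by rewrite k0E le_eqVlt; apply/orP; left; apply/eqP; ring.
  rewrite probability_setC// leeBlDr ?fin_num_measure// -leeBlDl//.
have taule : 0 <= 1 - tau by rewrite subr_ge0 ltW.
apply: (@le_trans _ _ ((1 - tau) * (1 - tau))%:E).
  by rewrite lee_fin; nra.
apply: (product_measure_ge mG taule PG') => w /hG[nz sz net].
have -> : xsection [set wr : Omega * Rnd |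
       (norm2 (mean (Filter p (gradient_step (beta1 wr.1) (T wr.1)) eps' wr.2)
               - betastar)
        <= c3 * D * Num.sqrt K * (sigma * (Num.sqrt (u / n%:R)
                          + Num.sqrt eps
                          + Num.sqrt (l / n%:R))))%R] w =
   [set r | norm2 (mean (Filter p (gradient_step (beta1 w) (T w)) eps' r) - betastar)
     <= c3 * D * Num.sqrt K * (sigma * (Num.sqrt (u / n%:R)
                          + Num.sqrt eps
                          + Num.sqrt (l / n%:R)))].
  by apply/seteqP; split => r; rewrite /xsection/= inE.
have trunc := uniform_truncated p0 _ hK1 kappa0 kappa1 M1 fg sz
  (fun k l => (net k l).1) (fun k l => (net k l).2).
have q0 : (0 < (p * n) ^ 3)%N by rewrite expn_gt0 (leq_trans _ q3).
have {}trunc a v a1 v1 := trunc q0 a v a1 v1.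
have noise_ok i : (datum betastar x z i w).2 - dotv (colv (datum betastar x z i w).1) betastar
    = sigma * noise betastar sigma (datum betastar x z i w).
  by rewrite -nz /datum /= /response addrAC subrr add0r.
have C0eps' : C0 * (16 * L * kappa) < 1 / 2 by rewrite epsE.
have [J [cJ stJ]] := stable_gradients p0 n0 hK1 sigma0 kappa0 L1 noise_ok (hbeta w)
   trunc C01 hD1 hD2 C0eps'.
rewrite epsE in cJ stJ.
have SE := gradient_step_sample betastar (beta1 w) x z w.
have sizeS : size (gradient_step (beta1 w) (sample betastar x z w)) = n.
  by rewrite SE (perm_size (perm_eq_seq_mset _)) size_map size_enum_ord.
have H := guarantee p n _ (gradient_step (beta1 w) (T w)) _ eps' _ sigma betastar
  p0 n0 eps'0 eps'1 sigma0 sizeS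
  (corrupted_le epsle (corrupted_map _ (hT w))) _ _ stJ.
apply: (filter_mean_ge hFilter eps'0 eps'1 (c1 := c1) (c2 := c2) (c3 := c3) (C0 := C0)
   (delta := D * Num.sqrt eps')).
  apply: le_trans (H _ _).
  - rewrite lee_fin lerD2l lerN2 -[leRHS](expRN_ln_inv tau0).
    apply: filter_failure; [exact: ltW|exact: l2|].
    rewrite -ler_pdivrMl//; apply: le_trans nK.
    rewrite mulrA ler_pM ?(ltW K0)//; first by rewrite mulr_ge0 ?invr_ge0 ?(ltW a0)// addr_ge0// mulr_ge0// ltW.
      by rewrite mulrC.
    by rewrite lerDl.
  - by rewrite SE; exact: msubset_map_enum.
  - by rewrite sizeS (perm_size (perm_eq_seq_mset _)) size_map -cardE.
have -> : c3 * D * Num.sqrt K * (sigma * (Num.sqrt (u / n%:R)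
                          + Num.sqrt eps + Num.sqrt (l / n%:R)))
   = sigma * (c3 * (D * (Num.sqrt K * (Num.sqrt (u / n%:R)
                          + Num.sqrt eps + Num.sqrt (l / n%:R))))) by ring.
rewrite ler_wpM2l// ler_wpM2l ?(ltW c30)// ler_wpM2l ?(ltW D0)//.
by apply: sqrt_rate; rewrite ?(ltW K0)// divr_ge0// ltW.
Qed.
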